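(* Let $p_1$ be a prime, $m\ge 1$ an integer and $N=p_1^m$. Let $p\ne p_1$ be a prime, $f=\mathrm{ord}_N(p)$ the multiplicative order of $p$ modulo $N$, $w=\phi(N)/f$, and $q=p^f$. Assume that $-1\notin\langle p\rangle$ in $(\mathbb{Z}/N\mathbb{Z})^*$, $\gcd(p(p-1),N)=1$ and $w\mid(p_1-1)$. Let $r$ be the largest nonnegative integer such that $p^r$ divides the Gauss sum $g(\chi)$ for a multiplicative character $\chi$ of $\mathbb{F}_q$ of order $N$ (see the context for its explicit value). Let $\gamma$ be a fixed primitive element of $\mathbb{F}_q$, let $C_i=\{\gamma^{i+jN}\mid 0\le j\le\frac{q-1}{N}-1\}$ for $0\le i\le N-1$, and let $D=\bigcup_{i=0}^{p_1^{m-1}-1}C_i$. Then $\mathrm{Cay}(\mathbb{F}_q,D)$ is a strongly regular graph if and only if there exist an integer $\ell$ with $1\le\ell\le w-1$ and a sign $\epsilon\in\{1,-1\}$ such that $$\frac{p^r(1-p_1)\ell}{w}\equiv\epsilon \pmod{p_1}$$ and $$p^{s}=\frac{\ell}{w}\left(p_1-\frac{(p_1-1)\ell}{w}\right),$$ where $s=f-2r$.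
   Context: $\phi$ is the Euler totient function and $\langle p\rangle$ is the cyclic subgroup of $(\mathbb{Z}/N\mathbb{Z})^*$ generated by $p$. For a multiplicative character $\chi$ of $\mathbb{F}_q$, the Gauss sum is $g(\chi)=\sum_{a\in\mathbb{F}_q^*}\chi(a)\psi(a)$, where $\psi(x)=\xi_p^{\mathrm{Tr}_{q/p}(x)}$, $\xi_p$ is a fixed complex primitive $p$-th root of unity and $\mathrm{Tr}_{q/p}$ is the trace from $\mathbb{F}_q$ to $\mathbb{F}_p$. Under the stated hypotheses, $g(\chi)$ for $\chi$ of order $N$ lies in the ring of integers $O_K$ of the decomposition field $K$ of $p$ in $\mathbb{Q}(\xi_N)$, where $\xi_N$ is a complex primitive $N$-th root of unity; $r$ is defined by $p^{-r}g(\chi)\in O_K$ and $p^{-(r+1)}g(\chi)\notin O_K$, and does not depend on the choice of $\chi$ of order $N$. It is a known fact that $$r=\frac{f-\tilde f}{2}+b,$$ where $\tilde f=\frac{p_1-1}{w}$, $b=\min\{b_0,b_1,\ldots,b_{w-1}\}$, and $b_j=\frac{1}{p_1}\sum_{z\in[1,p_1-1]\cap\tilde C_j}z$; here $[1,p_1-1]$ is the set of integers $x$ with $1\le x\le p_1-1$, and $\tilde C_j=g^j\langle p\rangle\subseteq(\mathbb{Z}/p_1\mathbb{Z})^*$ for $0\le j\le w-1$, with $g$ a primitive root modulo $p_1$ and $\langle p\rangle$ here the subgroup of $(\mathbb{Z}/p_1\mathbb{Z})^*$ generated by $p$. For $D\subseteq\mathbb{F}_q^*$ with $-D=D$, $\mathrm{Cay}(\mathbb{F}_q,D)$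 is the graph with vertex set $\mathbb{F}_q$ in which two vertices are adjacent if and only if their difference belongs to $D$. A strongly regular graph srg$(v,k,\lambda,\mu)$ is a simple undirected regular graph of order $v$ and valency $k$, neither complete nor edgeless, such that any two adjacent vertices have exactly $\lambda$ common neighbors and any two (distinct) nonadjacent vertices have exactly $\mu$ common neighbors; connectedness is not required. *)

(* Defs.v *)
From HB Require Import structures.
From mathcomp Require Import all_boot all_order all_fingroup all_algebra.
From mathcomp Require Import all_solvable all_field all_character.
Set Implicit Arguments.
Unset Strict Implicit.
Unset Printing Implicit Defensive.
Import Order.TTheory GRing.Theory Num.Theory.
Local Open Scope ring_scope.

(* The class of x in (Z/NZ)^*.  Meaningful only when 1 < N and x is coprime   *)
(* to N; the junk value for non-units is 1.                                   *)
Definition unit_mod (N : nat) (x : int) : {unit 'Z_N} :=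
  insubd (1%g : {unit 'Z_N}) (x%:~R : 'Z_N).

Section GaussSum.

Variables (p : nat) (F : finFieldType) (charF : p \in [pchar F]).

(* The library trace takes values in F; trace_Fp is the element of 'F_p whose *)
(* image a%:A in F is that value (it exists and is unique).                   *)
Definition trace_Fp (x : F) : 'F_p :=
  let L := pPrimeCharType charF in
  odflt 0 [pick a : 'F_p | galTrace 1%VS {: L} (x : L) == a%:A].

(* val is the representative of an element of 'F_p in {0, ..., p - 1}.        *)
Definition add_char (xi : algC) (x : F) : algC := xi ^+ val (trace_Fp x).

Definition gauss_sum (xi : algC) (chi : 'CF([set: {unit F}])) : algC :=
  \sum_(a : {unit F}) chi a * add_char xi (val a).

End GaussSum.

Section DecompositionField.

Variables (N p : nat) (z : algC).

(* Q(z), for z an N-th root of unity. *)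
Definition cyclotomic_field : {pred algC} :=
  Crat_span [seq z ^+ i | i <- iota 0 N].

Definition cyclotomic_int : {pred algC} :=
  [predI cyclotomic_field & Aint].

Definition prime_ideal_above (P : algC -> Prop) : Prop :=
  [/\ (forall x, P x -> x \in cyclotomic_int),
      [/\ P 0, (forall x y, P x -> P y -> P (x + y))
        & (forall a x, a \in cyclotomic_int -> P x -> P (a * x))],
      ~ P 1,
      (forall x y, x \in cyclotomic_int -> y \in cyclotomic_int ->
         P (x * y) -> P x \/ P y)
    & P p%:R].

(* Every automorphism of Q(z) extends to algC, and Q(z) is stable under those *)
(* of algC, so the restrictions to Q(z) of the s below form Gal(Q(z)/Q).      *)
Definition stabilizes (s : {rmorphism algC -> algC}) (P : algC -> Prop) : Prop :=
  forall y, P y <-> exists2 x, P x & y = s x.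

(* The fixed field of the decomposition group of a prime above p.  As Q(z)/Q  *)
(* is abelian, that group is the same for all such primes.                    *)
Definition in_decomposition_field (x : algC) : Prop :=
  x \in cyclotomic_field /\
  forall P, prime_ideal_above P -> forall s, stabilizes s P -> s x = x.

Definition in_decomposition_int (x : algC) : Prop :=
  in_decomposition_field x /\ x \in Aint.

End DecompositionField.

Definition cyclotomic_class (F : finFieldType) (gamma : {unit F}) (N i : nat) :
    {set F} :=
  [set val (gamma ^+ (i + j * N))%g | j : 'I_(#|F|.-1 %/ N)].

Definition cayley (F : finFieldType) (D : {set F}) : rel F :=
  fun x y => x - y \in D.

Definition is_srg (T : finType) (e : rel T) (v k lam mu : nat) : Prop :=
  [/\ symmetric e /\ irreflexive e,
      #|T| = v /\ (forall x, #|[set y | e x y]| = k),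
      (exists x y, x != y /\ ~~ e x y) /\ (exists x y, e x y),
      (forall x y, e x y -> #|[set z | e x z && e y z]| = lam)
    & (forall x y, x != y -> ~~ e x y -> #|[set z | e x z && e y z]| = mu)].

Definition strongly_regular (T : finType) (e : rel T) : Prop :=
  exists v k lam mu : nat, is_srg e v k lam mu.

(* Main.v *)
(* Let M = p1^(m-1), zeta = chi(gamma), omega = zeta^M and let eta_k be the
   sum of the additive character over the class {u | chi u = zeta^k}.  These
   Gaussian periods are rational integers (p - 1 is prime to N), and eta_k
   only depends on k up to multiplication by p.  As <p> has index prime to p1
   it contains every class congruent to 1 modulo p1; hence eta_(k+M) = eta_k
   when M does not divide k, which gives both
     g(chi) = sum_(c mod p1) beta_c omega^c,  beta_c = eta_(Mc) - eta_0,
   and the fact that the nontrivial eigenvalues of Cay(F_q, D) are exactly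
   the C + beta_c for some constant C.  So the graph is strongly regular if
   and only if the beta_c take a single nonzero value b.

   Three facts constrain the beta_c: their sum is -1 modulo p1; from
   |g(chi)|^2 = q, (p1 - 1) q + (sum beta_c)^2 = p1 sum beta_c^2; and they are
   constant on the orbits of p, which have size a multiple of
   e = (p1 - 1) / w.  If they lie in {0, b}, then b^2 divides q, so b is up to
   sign a power of p, namely p^r by maximality of r, and the two conditions
   hold with e * l the number of nonzero beta_c; l = w would force f = 2 r,
   while f is odd because -1 is not in <p>.  Conversely the two conditions
   determine the first two moments of the integers beta_c / p^r tightly enough
   to force all of them into {0, eps}. *)
Require Import Defs.
From mathcomp Require Import all_boot all_order all_fingroup all_algebra.
From mathcomp Require Import all_solvable all_field all_character.
From mathcomp Require Import zify ring.
Set Implicit Arguments.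
Unset Strict Implicit.
Unset Printing Implicit Defensive.
Import Order.TTheory GRing.Theory Num.Theory.
Local Open Scope ring_scope.

(** * The additive character *)

Section AdditiveCharacter.

Variables (p : nat) (F : finFieldType) (charF : p \in [pchar F]).
Variable xi : algC.
Hypothesis xi_prim : p.-primitive_root xi.

Local Notation L := (pPrimeCharType charF).
Local Notation psi := (Defs.add_char charF xi).

Let p_prime : prime p. Proof. exact: pcharf_prime charF. Qed.

Lemma trace_FpE (x : F) :
  galTrace 1%VS {: L} (x : L) = (trace_Fp charF x)%:A :> L.
Proof.
have gal1 : galois 1%VS {: L} by exact: finField_galois (sub1v _).
have /vlineP[a Da] := mem_galTrace gal1 (memvf (x : L)).
rewrite /trace_Fp; case: pickP => [b /eqP // | /(_ a)].
by rewrite Da eqxx.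
Qed.

Lemma trace_FpD : {morph trace_Fp charF : x y / x + y}.
Proof.
move=> x y; have inj := fmorph_inj (in_alg L); apply: inj.
by rewrite rmorphD /= -!trace_FpE raddfD.
Qed.

(** Galois automorphisms commute with the Frobenius map, so the trace of [x ^+ p] is the [p]-th
    power of the trace of [x]; elements of the prime field are fixed by that power. *)
Lemma trace_Fp_frob (x : F) : trace_Fp charF (x ^+ p) = trace_Fp charF x.
Proof.
have inj := fmorph_inj (in_alg L); apply: inj.
rewrite /= -!trace_FpE.
have charL : p \in [pchar L] by [].
have -> : galTrace 1 {:L} ((x ^+ p : F) : L) = (galTrace 1 {:L} (x : L)) ^+ p.
  rewrite -[RHS](pFrobenius_autE charL) /galTrace rmorph_sum.
  by apply: eq_bigr => s _; exact: rmorphXn.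
rewrite trace_FpE exprZn expr1n; congr (_ *: _).
by have := expf_card (trace_Fp charF x); rewrite card_Fp.
Qed.

(** A vanishing trace would be a linear relation with all coefficients 1 between the Galois
    automorphisms, which are linearly independent. *)
Lemma trace_Fp_neq0 : exists x, trace_Fp charF x != 0.
Proof.
apply/existsP; apply: contraT; rewrite negb_exists => /forallP tr0.
have tr0' a : a \in {: L}%VS ->
    \sum_(s in 'Gal({: L} / 1%VS)%g) 1 * (s : gal_of {: L}) a = 0.
  move=> _; rewrite (eq_bigr (fun s : gal_of {: L} => s a)) => [|s _]; last first.
    by rewrite mul1r.
  by have := trace_FpE a; rewrite /galTrace => ->; move: (tr0 a); rewrite negbK => /eqP ->; rewrite scale0r.
have := gal_independent tr0' (group1 _).
by move/eqP; rewrite oner_eq0.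
Qed.

Lemma add_charD x y : psi (x + y) = psi x * psi y.
Proof.
rewrite /Defs.add_char trace_FpD -exprD /= expr_mod //.
by rewrite Fp_cast // (prim_expr_order xi_prim).
Qed.

Lemma add_char0 : psi 0 = 1.
Proof.
have := add_charD 0 0; rewrite addr0 => /eqP.
rewrite -subr_eq0 -{1}[psi 0]mulr1 -mulrBr mulf_eq0 subr_eq0 => /orP[|/eqP <-//].
by rewrite expf_eq0 (prim_root_eq0 xi_prim) (gtn_eqF (prime_gt0 p_prime)) andbF.
Qed.

Lemma add_charMn x n : psi (x *+ n) = psi x ^+ n.
Proof.
elim: n => [|n IHn]; first by rewrite mulr0n add_char0.
by rewrite mulrSr exprSr add_charD IHn.
Qed.

Lemma add_char_unity x : psi x ^+ p = 1.
Proof. by rewrite -add_charMn (mulrn_pchar charF) add_char0. Qed.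

Lemma add_char_frob x : psi (x ^+ p) = psi x.
Proof. by rewrite /Defs.add_char trace_Fp_frob. Qed.

Lemma sum_add_char y : \sum_x psi (x * y) = (#|F| * (y == 0))%:R.
Proof.
have [-> | ny] := eqVneq y 0.
  under eq_bigr do rewrite mulr0 add_char0.
  by rewrite sumr_const muln1.
rewrite muln0.
have [x0 nx0] := trace_Fp_neq0.
have psi_x0 : psi x0 != 1.
  rewrite -(prim_order_dvd xi_prim) gtnNdvd // ?lt0n //.
  by rewrite -[ltnRHS](Fp_cast p_prime) ltn_ord.
(* Translating the summation variable by [x0 / y] multiplies [S] by [psi x0], which is not 1. *)
pose S := \sum_x psi (x * y).
suff : psi x0 * S = S.
  move/eqP; rewrite -subr_eq0 -{2}[S]mul1r -mulrBl mulf_eq0 subr_eq0.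
  by rewrite (negbTE psi_x0) => /eqP.
rewrite mulr_sumr [RHS](reindex_inj (addrI (x0 / y))) /=.
by apply: eq_bigr => x _; rewrite mulrDl mulfVK // add_charD.
Qed.

End AdditiveCharacter.

(** * Strongly regular Cayley graphs and character sums *)

Section CayleyGraph.

Variables (F : finFieldType) (psi : F -> algC).
Hypothesis psiD : forall x y, psi (x + y) = psi x * psi y.
Hypothesis sum_psi : forall y, \sum_x psi (x * y) = (#|F| * (y == 0))%:R.

Variable D : {set F}.
Hypothesis D0 : 0 \notin D.
Hypothesis DN : forall x, (- x \in D) = (x \in D).

(** By [sum_psi], [psi] is a nontrivial additive character, so these are the eigenvalues of the
    Cayley graph; [y = 0] gives the valency. *)
Definition char_sum y := \sum_(d in D) psi (d * y).
Definition diff_count t := #|[set d in D | t + d \in D]|.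

Lemma card_field_neq0 : #|F|%:R != 0 :> algC.
Proof. by rewrite pnatr_eq0 -lt0n; apply/card_gt0P; exists 0. Qed.

Lemma psi_at0 : psi 0 = 1.
Proof.
apply: (mulIf card_field_neq0); rewrite mul1r mulr_natr.
have := sum_psi 0; under eq_bigr do rewrite mulr0.
by rewrite sumr_const eqxx muln1.
Qed.

Lemma char_sumN y : char_sum (- y) = char_sum y.
Proof.
rewrite /char_sum (reindex_inj oppr_inj) /=.
by apply: eq_big => [x|x _]; rewrite ?DN // mulrNN.
Qed.

(** [diff_count] is the autocorrelation of the indicator of [D], so its transform is
    [char_sum y * char_sum (- y)]; the symmetry of [D] turns this into a square. *)
Lemma diff_count_fourier y :
  \sum_t (diff_count t)%:R * psi (t * y) = char_sum y ^+ 2.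
Proof.
rewrite expr2 -{2}char_sumN /char_sum mulr_suml.
transitivity (\sum_t \sum_(d in D) (t + d \in D)%:R * psi (t * y)).
  apply: eq_bigr => t _; rewrite -mulr_suml; congr (_ * _).
  rewrite /diff_count -sum1_card natr_sum big_mkcond [RHS]big_mkcond /=.
  by apply: eq_bigr => d _; rewrite inE; case: (d \in D); case: (_ \in D).
rewrite exchange_big [RHS](eq_bigr _ (fun _ _ => mulr_sumr _ _ _ _)).
rewrite [RHS]exchange_big; apply: eq_bigr => d _ /=.
rewrite (reindex_inj (addIr (- d))) /= [RHS]big_mkcond /=.
apply: eq_bigr => u _; rewrite subrK -psiD mulrN -mulNr -mulrDl.
by case: (u \in D); rewrite ?mul1r ?mul0r.
Qed.

Lemma fourier_inversion (h : F -> algC) x :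
  \sum_y psi (- x * y) * (\sum_t h t * psi (t * y)) = #|F|%:R * h x.
Proof.
under eq_bigr do rewrite mulr_sumr.
rewrite exchange_big (bigD1 x) //= [X in _ + X]big1 ?addr0 => [|t ntx].
  under eq_bigr do rewrite mulrCA -psiD -mulrDl addNr mul0r psi_at0 mulr1.
  by rewrite sumr_const mulr_natl.
under eq_bigr => y _ do rewrite mulrCA -psiD -mulrDl [_ * y]mulrC.
by rewrite -mulr_sumr sum_psi addrC subr_eq0 (negbTE ntx) muln0 mulr0n mulr0.
Qed.

Lemma card_common_neighbors x y :
  #|[set z | cayley D x z && cayley D y z]| = diff_count (x - y).
Proof.
rewrite -(card_imset _ (can_inj (subKr y))) /diff_count; apply: eq_card => d.
rewrite !inE; apply/imsetP/andP => [[z]|[Dd Dxyd]].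
  by rewrite inE => /andP[xz yz] ->; rewrite addrA subrK.
by exists (y - d); rewrite ?subKr // inE /cayley subKr Dd opprB addrA addrAC Dxyd.
Qed.

Lemma card_neighbors x : #|[set y | cayley D x y]| = #|D|.
Proof.
rewrite -(card_imset _ (can_inj (subKr x))); apply: eq_card => d.
apply/imsetP/idP => [[z]|Dd]; first by rewrite inE => xz ->.
by exists (x - d); rewrite ?subKr // inE /cayley subKr.
Qed.

(** Strong regularity expresses [diff_count] through a constant, the indicator of [D] and that of 0.
    At a nonzero frequency the transform kills the constant and leaves a quadratic equation with
    coefficients independent of [y]. *)
Lemma srg_char_sum_quadratic : strongly_regular (cayley D) ->
  exists P Q, forall y, y != 0 -> char_sum y ^+ 2 = P * char_sum y + Q.
Proof.
case=> [v [k [lam [mu [[_ _] [_ deg] _ adj nadj]]]]].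
exists (lam%:R - mu%:R), (k%:R - mu%:R) => y ny.
have c_eq t : (diff_count t)%:R =
    mu%:R + (lam%:R - mu%:R) * (t \in D)%:R + (k%:R - mu%:R) * (t == 0)%:R :> algC.
  have := card_common_neighbors t 0; rewrite subr0 => <-.
  have [-> | nt] := eqVneq t 0.
    rewrite (negbTE D0) mulr0 mulr1 addr0 addrC subrK -(deg 0); congr _%:R.
    by apply: eq_card => z; rewrite !inE andbb.
  have [Dt | nDt] := boolP (t \in D).
    by rewrite mulr1 mulr0 addr0 addrC subrK adj // /cayley subr0.
  by rewrite !mulr0 !addr0 nadj // /cayley subr0.
rewrite -diff_count_fourier.
have -> : char_sum y = \sum_t (t \in D)%:R * psi (t * y).
  rewrite /char_sum big_mkcond; apply: eq_bigr => t _.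
  by case: (t \in D); rewrite ?mul1r ?mul0r.
under eq_bigr do rewrite c_eq [(_ + _) * psi _]mulrDl [(_ + _) * psi _]mulrDl -!mulrA.
rewrite !big_split /= -!mulr_sumr sum_psi (negbTE ny) muln0 mulr0 add0r.
congr (_ + _); rewrite (bigD1 0) //= eqxx mul1r mul0r psi_at0 big1 ?addr0 ?mulr1 //.
by move=> t nt; rewrite (negbTE nt) mul0r.
Qed.

(** Fourier inversion of a quadratic relation between the eigenvalues shows that, away from 0,
    [diff_count] is an affine function of the indicator of [D]. *)
Lemma two_char_sums_srg a b :
    (exists x, x \in D) -> (exists x, (x != 0) && (x \notin D)) ->
    (forall y, y != 0 -> char_sum y = a \/ char_sum y = b) ->
  strongly_regular (cayley D).
Proof.
move=> [x1 Dx1] [x2 /andP[nx2 nDx2]] two.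
(* [K] is the value of [(X - a) * (X - b)] at the valency: the relation fails only at [y = 0], and
   inversion turns this defect into an additive constant. *)
pose K := char_sum 0 ^+ 2 - (a + b) * char_sum 0 + a * b.
have sqr_eq y : char_sum y ^+ 2 = (a + b) * char_sum y - a * b + K * (y == 0)%:R.
  have [-> | ny] := eqVneq y 0; first by rewrite /K mulr1; ring.
  by rewrite mulr0 addr0; case: (two y ny) => ->; ring.
have count_eq x : x != 0 ->
    #|F|%:R * (diff_count x)%:R = (a + b) * (#|F|%:R * (x \in D)%:R) + K :> algC.
  move=> nx; rewrite -(fourier_inversion (fun t => (diff_count t)%:R)).
  rewrite -(fourier_inversion (fun t => (t \in D)%:R)).
  under eq_bigr do rewrite diff_count_fourier sqr_eq !mulrDr.
  rewrite !big_split /=.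
  have -> : \sum_y psi (- x * y) * - (a * b) = 0.
    under eq_bigr do rewrite [- x * _]mulrC.
    by rewrite -mulr_suml sum_psi oppr_eq0 (negbTE nx) muln0 mul0r.
  rewrite addr0; congr (_ + _).
    rewrite mulr_sumr; apply: eq_bigr => y _; rewrite mulrCA; congr (_ * (_ * _)).
    rewrite /char_sum big_mkcond; apply: eq_bigr => t _.
    by case: (t \in D); rewrite ?mul1r ?mul0r.
  rewrite (bigD1 0) //= mulr0 psi_at0 eqxx mul1r mulr1 big1 ?addr0 // => y ny.
  by rewrite (negbTE ny) !mulr0.
have const x y : x != 0 -> y != 0 -> (x \in D) = (y \in D) ->
    diff_count x = diff_count y.
  move=> nx ny eqD; apply/eqP; rewrite -(eqr_nat algC).
  by apply/eqP/(mulfI card_field_neq0); rewrite !count_eq // eqD.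
have nD x : x \in D -> x != 0 by apply: contraTneq => ->.
exists #|F|, #|D|, (diff_count x1), (diff_count x2); split.
- split=> [x y|x]; last by rewrite /cayley subrr (negbTE D0).
  by rewrite /cayley -DN opprB.
- by split=> // x; rewrite card_neighbors.
- by split; [exists x2, 0 | exists x1, 0]; rewrite /cayley subr0.
- move=> x y xy; rewrite card_common_neighbors; apply: const; rewrite ?nD //.
  by rewrite Dx1; exact: xy.
- move=> x y nxy xy; rewrite card_common_neighbors; apply: const => //.
    by rewrite subr_eq0.
  by rewrite (negbTE nDx2); exact: negbTE.
Qed.

End CayleyGraph.

(** * Powers of p modulo N *)

(** Each [q]-th power gains a factor [q]: in [Y ^ q - 1 = (Y - 1) * S], the sum [S] has [q] terms,
    all congruent to 1 modulo [q]. *)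
Lemma mod1_exp_prime_power (q y j : nat) :
  prime q -> y = 1 %[mod q] -> y ^ (q ^ j) = 1 %[mod q ^ j.+1].
Proof.
move=> q_pr y1; have q_gt1 := prime_gt1 q_pr.
have y_gt0 : (0 < y)%N.
  by case: y y1 => // /eqP; rewrite mod0n modn_small.
elim: j => [|j IHj]; first by rewrite expn0 !expn1.
have Yj1 : (y ^ q ^ j = 1 %[mod q])%N by rewrite -modnXm y1 modnXm exp1n.
rewrite [in LHS]expnSr expnM; move: (y ^ q ^ j)%N (expn_gt0 y (q ^ j)) Yj1 IHj => Y.
rewrite y_gt0 => Y_gt0 Y1 /eqP; rewrite eqn_mod_dvd // => dvdY.
apply/eqP; rewrite eqn_mod_dvd ?expn_gt0 ?Y_gt0 //.
have := subn_exp Y 1 q; rewrite exp1n => ->; rewrite expnSr dvdn_mul //.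
rewrite /dvdn -modn_summ (eq_bigr (fun=> 1%N)) => [|i _]; last first.
  by rewrite exp1n muln1 -modnXm Y1 modnXm exp1n modn_small.
by rewrite sum_nat_const card_ord muln1 modnn.
Qed.

Section PowersModulo.

Variables (p1 m N p f w : nat).
Hypothesis p1_prime : prime p1.
Hypothesis m_ge1 : (1 <= m)%N.
Hypothesis N_def : N = (p1 ^ m)%N.
Hypothesis p_prime : prime p.
Hypothesis f_def : f = #[unit_mod N p%:Z]%g.
Hypothesis w_def : w = (totient N %/ f)%N.
Hypothesis Nm1_notin : unit_mod N (-1) \notin <[unit_mod N p%:Z]>%g.
Hypothesis coprime_N : gcdn (p * (p - 1)) N = 1%N.
Hypothesis w_dvd : (w %| p1 - 1)%N.

Local Notation M := (p1 ^ (m - 1))%N.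
Local Notation e := ((p1 - 1) %/ w)%N.

Lemma modulus_gt1 : (1 < N)%N.
Proof. by rewrite N_def -(exp1n m) ltn_exp2r // prime_gt1. Qed.

Lemma predm_succ : (m - 1).+1 = m.
Proof. by rewrite subn1 prednK. Qed.

Lemma modulusE : N = (p1 * M)%N.
Proof. by rewrite N_def -expnS subn1 prednK. Qed.

Lemma p1_dvd_N : (p1 %| N)%N.
Proof. by rewrite modulusE dvdn_mulr. Qed.

Lemma coprime_p_N : coprime p N.
Proof. by move: coprime_N => /eqP; rewrite -/(coprime _ _) coprimeMl => /andP[]. Qed.

Lemma coprime_predp_N : coprime (p - 1) N.
Proof. by move: coprime_N => /eqP; rewrite -/(coprime _ _) coprimeMl => /andP[]. Qed.

Lemma coprime_modulus x : coprime x N = coprime x p1.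
Proof. by rewrite N_def coprime_pexpr. Qed.

Lemma odd_p1 : odd p1.
Proof.
have [p1_2|//] := even_prime p1_prime.
have := coprime_p_N; have := coprime_predp_N.
rewrite !coprime_modulus p1_2 !coprimen2 oddB ?prime_gt0 //= addbT.
by move/negP.
Qed.

Lemma val_unit_mod x : coprime x N -> val (unit_mod N x%:Z) = x%:R :> 'Z_N.
Proof.
move=> co_x; rewrite /unit_mod val_insubd /= pmulrn.
by rewrite unitZpE ?modulus_gt1 // coprime_sym co_x.
Qed.

Lemma natr_Zp_eq a b : (a%:R == b%:R :> 'Z_N) = (a == b %[mod N]).
Proof. by rewrite -val_eqE /= !val_Zp_nat ?modulus_gt1. Qed.

Lemma order_dvd_exp n : (f %| n)%N = (p ^ n == 1 %[mod N]).
Proof.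
rewrite f_def order_dvdn -val_eqE /= FinRing.val_unitX.
by rewrite (val_unit_mod coprime_p_N) -natrX -[1]/(1%:R) natr_Zp_eq.
Qed.

Lemma exp_order : p ^ f = 1 %[mod N].
Proof. by apply/eqP; rewrite -order_dvd_exp. Qed.

Lemma f_gt0 : (0 < f)%N. Proof. by rewrite f_def order_gt0. Qed.

Lemma card_unit_Zp : #|[set: {unit 'Z_N}]| = totient N.
Proof. by rewrite -card_units_Zp ?(ltnW modulus_gt1) // /units_Zp. Qed.

Lemma mul_fw : (f * w = M * (p1 - 1))%N.
Proof.
rewrite w_def mulnC divnK; last first.
  by rewrite f_def -card_unit_Zp cardSg ?subsetT.
by rewrite N_def totient_pfactor // subn1 mulnC subn1.
Qed.

Lemma w_gt0 : (0 < w)%N.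
Proof.
have : (0 < f * w)%N by rewrite mul_fw muln_gt0 expn_gt0 subn_gt0 prime_gt0 ?prime_gt1.
by rewrite muln_gt0 => /andP[].
Qed.

Lemma mul_ew : (e * w = p1 - 1)%N.
Proof. by rewrite divnK. Qed.

Lemma f_factor : f = (M * e)%N.
Proof.
by apply/eqP; rewrite -(eqn_pmul2r w_gt0) mul_fw -mulnA mul_ew.
Qed.

(** The class [u] of [y] is killed by the exponent [M], and [u ^+ w] lies in [<p>], whose index is
    [w]. As [w] divides [p1 - 1] it is prime to [M], so [u] is a power of [u ^+ w]. *)
Lemma one_mod_power y : y = 1 %[mod p1] -> exists i, y = p ^ i %[mod N].
Proof.
move=> y1; have y_co : coprime y N.
  rewrite coprime_modulus -coprime_modl y1 coprime_modl; exact: coprime1n.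
pose u := unit_mod N y%:Z; pose P := <[unit_mod N p%:Z]>%G.
have uM : (u ^+ M = 1)%g.
  apply/val_inj; rewrite FinRing.val_unitX val_unit_mod // -natrX.
  apply/eqP; rewrite FinRing.val_unit1 -[1]/(1%:R) natr_Zp_eq.
  have := mod1_exp_prime_power (m - 1) p1_prime y1.
  by rewrite predm_succ -N_def => ->.
have uw : (u ^+ w)%g \in P.
  have -> : w = #|[set: {unit 'Z_N}] / P|%g.
    rewrite card_quotient ?sub_abelian_norm ?subsetT ?units_Zp_abelian //.
    by rewrite -divgS ?subsetT // card_unit_Zp w_def f_def.
  have nPu : u \in 'N(P)%g.
    by rewrite (subsetP (sub_abelian_norm (units_Zp_abelian N) (subsetT _))) ?inE.
  by apply: coset_idr; rewrite ?groupX // morphX // expg_cardG // mem_quotient ?inE.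
have co_wM : coprime w M.
  apply: coprimeXr; rewrite coprime_sym prime_coprime //; apply/negP => dv.
  have := dvdn_leq _ (dvdn_trans dv w_dvd); rewrite subn_gt0 prime_gt1 // => /(_ isT).
  by rewrite subn1 leqNgt ltn_predL prime_gt0.
have uP : u \in P.
  rewrite -cycle_subG; have /eqP-> : generator <[u]>%g (u ^+ w)%g.
    rewrite generator_coprime; apply: (@coprime_dvdl _ M); last by rewrite coprime_sym.
    by rewrite order_dvdn uM.
  by rewrite cycle_subG.
have /cycleP[i ui] : u \in <[unit_mod N p%:Z]>%g by [].
exists i; apply/eqP; rewrite -natr_Zp_eq -val_unit_mod // -/u ui.
by rewrite FinRing.val_unitX val_unit_mod ?coprime_p_N // natrX.
Qed.

(** If [f = 2 * h], then [N] divides [(Y - 1) * (Y + 1)] with [Y = p ^ h]. The odd prime [p1] cannot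
    divide both factors, and [N] does not divide [Y - 1] because [h < f]; hence [Y] is -1 modulo
    [N], contrary to the assumption on -1. *)
Lemma odd_f : odd f.
Proof.
apply: contraT => even_f.
pose h := f./2; have fE : f = (h * 2)%N.
  by rewrite -[LHS]odd_double_half (negbTE even_f) muln2.
have h_gt0 : (0 < h)%N by have := f_gt0; rewrite fE muln_gt0 => /andP[].
pose Y := (p ^ h)%N.
have Y_gt0 : (0 < Y)%N by rewrite expn_gt0 prime_gt0.
have dvdYY : (N %| (Y - 1) * (Y + 1))%N.
  have Y2 : (1 <= Y ^ 2)%N by rewrite expn_gt0 Y_gt0.
  rewrite -subn_sqr exp1n -eqn_mod_dvd // -expnM -fE.
  exact/eqP/exp_order.
have ndvdY1 : ~~ (N %| Y - 1)%N.
  rewrite -eqn_mod_dvd // -order_dvd_exp fE gtnNdvd //.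
  by rewrite muln2 -addnn -[X in (X < _)%N]addn0 ltn_add2l.
have dvdYS : (N %| Y + 1)%N.
  have [dv|ndv] := boolP (p1 %| Y - 1)%N; last first.
    rewrite -(Gauss_dvdr _ (_ : coprime N (Y - 1))) // coprime_sym coprime_modulus.
    by rewrite coprime_sym prime_coprime.
  case/negP: ndvdY1; rewrite -(Gauss_dvdl _ (_ : coprime N (Y + 1))) //.
  rewrite coprime_sym coprime_modulus coprime_sym prime_coprime //.
  have -> : (Y + 1 = (Y - 1) + 2)%N by rewrite -[2%N]/(1 + 1)%N addnA subnK.
  have p1_neq1 : p1 != 1%N by rewrite gtn_eqF ?prime_gt1.
  rewrite (dvdn_addr _ dv); apply/negP.
  move=> /(prime_nt_dvdP (isT : prime 2) p1_neq1) p1_2.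
  by have := odd_p1; rewrite p1_2.
case/negP: Nm1_notin; apply/cycleP; exists h; apply/val_inj.
rewrite FinRing.val_unitX val_unit_mod ?coprime_p_N // -natrX -/Y.
have <- : -1 = Y%:R :> 'Z_N.
  apply/eqP; rewrite -subr_eq0 -opprD oppr_eq0 addrC -(natrD _ Y 1).
  by rewrite -[0]/(0%:R) natr_Zp_eq mod0n.
by rewrite /unit_mod val_insubd unitrN1.
Qed.

(** Raising to the power [M] lifts the congruence to the modulus [N], so [f = M * e] divides
    [n * M]. Thus [e] divides the order of [p] modulo [p1]. *)
Lemma dvd_e n : p ^ n = 1 %[mod p1] -> (e %| n)%N.
Proof.
move=> /(mod1_exp_prime_power (m - 1) p1_prime).
rewrite predm_succ -N_def -expnM => /eqP; rewrite -order_dvd_exp.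
by rewrite f_factor mulnC dvdn_pmul2r // expn_gt0 prime_gt0.
Qed.

(** If [e = 1] then [f = M], a power of [p1]; by Fermat [p ^ M] is [p] modulo [p1], so [p1] would
    divide [p - 1]. *)
Lemma e_gt1 : (1 < e)%N.
Proof.
rewrite ltn_neqAle -(ltn_pmul2r w_gt0) mul0n mul_ew subn_gt0 prime_gt1 // andbT.
apply/eqP => e1; have := exp_order; rewrite f_factor -e1 muln1.
have p_fix j : p ^ (p1 ^ j) = p %[mod p1].
  elim: j => [|j IHj]; first by rewrite expn1.
  by rewrite expnSr expnM -modnXm IHj modnXm fermat_little.
move=> pM; have : p = 1 %[mod p1].
  by rewrite -(p_fix (m - 1)%N) -(modn_dvdm _ p1_dvd_N) pM (modn_dvdm _ p1_dvd_N).
move/eqP; rewrite eqn_mod_dvd ?prime_gt0 //; apply/negP.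
by rewrite -prime_coprime // coprime_sym -coprime_modulus coprime_predp_N.
Qed.

Lemma shift_power k : ~~ (M %| k)%N -> exists i, k + M = k * p ^ i %[mod N].
Proof.
move=> ndv; have k_gt0 : (0 < k)%N by case: k ndv => //; rewrite dvdn0.
have [u] := pfactor_coprime p1_prime k_gt0; move: (logn p1 k) => v co_u kE.
have v_lt : (v < m - 1)%N.
  by rewrite ltnNge; apply: contra ndv => le; rewrite kE dvdn_mull // dvdn_exp2l.
pose d := (m - 1 - v)%N; have d_gt0 : (0 < d)%N by rewrite subn_gt0.
(* [u ^ (p1 - 2)] is the inverse of [u] modulo [p1]. With [k = u * p1 ^ v], this makes [k * y] equal
   to [k + M * u ^ (p1 - 1)], which is [k + M] modulo [N]; and [y] is 1 modulo [p1] since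
   [d > 0]. *)
pose y := (1 + p1 ^ d * u ^ (p1 - 2))%N.
have [|i yi] := @one_mod_power y.
  by rewrite -modnDmr -(prednK d_gt0) expnS -mulnA modnMr addn0.
exists i; rewrite -modnMmr -yi modnMmr mulnDr muln1.
have -> : (k * (p1 ^ d * u ^ (p1 - 2)) = M * u ^ totient p1)%N.
  have -> : (m - 1 = v + d)%N by rewrite subnKC // ltnW.
  have -> : totient p1 = (p1 - 2).+1.
    by rewrite totient_prime // -subSn ?prime_gt1 // subSS subn1.
  by rewrite kE expnD expnS [(u * p1 ^ v)%N]mulnC -!mulnA; congr (_ * _)%N; rewrite mulnCA.
apply/eqP; rewrite eqn_modDl modulusE [(p1 * _)%N]mulnC; apply/eqP.
rewrite -muln_modr Euler_exp_totient 1?coprime_sym //.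
by rewrite muln_modr muln1.
Qed.

(** The nonzero residues split into cosets of the group generated by [p]. On each of them [h] is
    constant, and their common size is a multiple of [e] by [dvd_e]. *)
Lemma dvd_sum_stable (h : 'F_p1 -> int) :
  (forall c, h (p%:R * c) = h c) -> (e%:Z %| (\sum_(c : 'F_p1 | c != 0) h c)%R)%Z.
Proof.
move=> h_p.
have pN0 : (p%:R : 'F_p1) != 0.
  rewrite -(dvdn_pcharf (pchar_Fp p1_prime)) -prime_coprime // coprime_sym.
  by rewrite -coprime_modulus coprime_p_N.
have pU : (p%:R : 'F_p1) \is a GRing.unit by rewrite unitfE.
pose u : {unit 'F_p1} := Sub (p%:R : 'F_p1) pU.
have dv_e : (e %| #[u]%g)%N.
  apply: dvd_e; have := congr1 val (expg_order u).
  rewrite FinRing.val_unitX /= -natrX => /(congr1 val).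
  by rewrite /= val_Fp_nat // => ->; rewrite Fp_cast.
set S := (X in (_ %| X)%Z); have -> : S = \sum_(x : {unit 'F_p1}) h (val x).
  rewrite /S [RHS](reindex_onto (fun c : 'F_p1 => insubd (1%g : {unit _}) c) val) /=.
    apply: eq_big => [c|c nc].
      by rewrite val_insubd unitfE; case: eqVneq => [->|_]; rewrite ?eqxx //= oner_eq0.
    by rewrite val_insubd unitfE nc.
  by move=> x _; exact: valKd.
have h_u n x : h (val (u ^+ n * x)%g) = h (val x).
  elim: n => [|n IHn]; first by rewrite mul1g.
  by rewrite expgS -mulgA FinRing.val_unitM h_p.
rewrite (partition_big (fun x => <[u]> :* x)%g predT) //=; apply: rpred_sum => A _.
have [x0 /eqP <- | none] := pickP (fun x => <[u]> :* x == A)%g; last first.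
  by rewrite big_pred0 ?rpred0.
rewrite (eq_bigr (fun=> h (val x0))) => [|x /eqP/rcoset_eqP/rcosetP[_ /cycleP[n ->] ->]].
  rewrite (eq_bigl [in <[u]> :* x0]%g) => [|x]; last exact/eqP/rcoset_eqP.
  rewrite sumr_const card_rcoset -mulr_natr; apply: dvdz_mull.
  by rewrite natz dvdzE.
by rewrite h_u.
Qed.

End PowersModulo.

(** * The decomposition group of p *)

Lemma poly_int_dvd_prime (p : nat) (Q : {poly int}) : prime p ->
  map_poly (intr : int -> 'F_p) Q = 0 -> exists R, Q = p%:R * R.
Proof.
move=> p_pr Q0; exists (\poly_(i < size Q) (Q`_i %/ p%:Z)%Z).
apply/polyP => i; rewrite mulr_natl coefMn coef_poly.
case: ltnP => [_|le]; last by rewrite nth_default // mul0rn.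
rewrite -mulr_natr natz divzK //.
by rewrite (dvdz_pcharf (pchar_Fp p_pr)) -coef_map Q0 coef0.
Qed.

Section DecompositionGroup.

Variables (N p : nat) (z : algC).
Hypothesis z_prim : N.-primitive_root z.
Hypothesis p_prime : prime p.
Hypothesis p_co : coprime p N.

(** Elements of [Z[z]] are handled as values of integer polynomials, which can be reduced modulo
    [p]. *)
Let phi : {rmorphism {poly int} -> algC} := horner_eval z \o map_poly intr.

Lemma phiXn k : phi 'X^k = z ^+ k.
Proof. by rewrite /phi /= /horner_eval map_polyXn hornerXn. Qed.

Lemma mem_cyclotomic_field k : z ^+ k \in cyclotomic_field N z.
Proof.
rewrite -(prim_expr_mod z_prim); apply/mem_Crat_span/map_f.
by rewrite mem_iota ltn_mod (prim_order_gt0 z_prim).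
Qed.

Lemma phi_cyclotomic_int Q : phi Q \in cyclotomic_int N z.
Proof.
have -> : phi Q = \sum_(i < size Q) (Q`_i)%:~R * z ^+ i.
  rewrite -[Q in LHS]coefK poly_def rmorph_sum; apply: eq_bigr => i _.
  by rewrite -mul_polyC rmorphM phiXn /= /horner_eval map_polyC hornerC.
apply/andP; split; last first.
  by apply: rpred_sum => i _; rewrite rpredM ?rpredX ?Aint_int // (Aint_prim_root z_prim).
apply: rpred_sum => i _; apply: Crat_spanM (mem_cyclotomic_field i).
by rewrite rpred_int.
Qed.

Variable P : algC -> Prop.
Hypothesis P_prime : prime_ideal_above N p z P.

Let P0 : P 0. Proof. by case: P_prime => _ []. Qed.
Let PD x y : P x -> P y -> P (x + y). Proof. by case: P_prime => _ [_ PD _] _ _ _; apply: PD. Qed.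
Let PM Q x : P x -> P (phi Q * x).
Proof. by case: P_prime => _ [_ _ PM] _ _ _; apply: PM; exact: phi_cyclotomic_int. Qed.
Let PN x : P x -> P (- x).
Proof. by move/(PM (-1)); rewrite rmorphN1 mulN1r. Qed.
Let P1 : ~ P 1. Proof. by case: P_prime. Qed.
Let Pp : P p%:R. Proof. by case: P_prime. Qed.

Lemma prime_ideal_prod (I : Type) (r : seq I) (Q : I -> {poly int}) :
  P (phi (\prod_(i <- r) Q i)) -> exists i, P (phi (Q i)).
Proof.
elim: r => [|i r IHr]; first by rewrite big_nil rmorph1 => /P1.
rewrite big_cons rmorphM; have [_ _ _ Pr _] := P_prime.
by case/(Pr _ _ (phi_cyclotomic_int _) (phi_cyclotomic_int _)) => // Pi; exists i.
Qed.

Lemma phi_mod_p Q : map_poly (intr : int -> 'F_p) Q = 0 -> P (phi Q).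
Proof.
case/(poly_int_dvd_prime p_prime) => R ->.
by rewrite mulrC rmorphM rmorph_nat; apply: PM.
Qed.

Variable f : nat.
Hypothesis f_gt0 : (0 < f)%N.
Hypothesis f_order : forall n, (f %| n)%N = (p ^ n == 1 %[mod N]).

(* The Fourier coefficients of the indicator function of the powers of p: they *)
(* are congruent to integers modulo P, hence fixed modulo P by s, which makes  *)
(* that indicator function s-invariant.                                        *)
Definition period k : {poly int} := \sum_(i < f) 'X^(k * p ^ i).

Lemma phi_period k : phi (period k) = \sum_(i < f) z ^+ (k * p ^ i).
Proof. by rewrite rmorph_sum; apply: eq_bigr => i _; rewrite phiXn. Qed.

(** Modulo [p], [period (k * p)] is the [p]-th power of [period k], while both have the same image
    under [phi], since multiplication by [p] permutes the exponents [k * p ^ i] modulo [N]. As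
    [X ^ p - X] is the product of the [X - x] over ['F_p], one factor lies in the prime [P]. *)
Lemma period_rational k : exists n : nat, P (phi (period k) - n%:R).
Proof.
pose Q := \prod_(x : 'F_p) (period k - (val x)%:R) - (period (k * p) - period k).
have Q0 : map_poly (intr : int -> 'F_p) Q = 0.
  pose g : {rmorphism {poly int} -> {poly 'F_p}} := map_poly intr.
  rewrite -[LHS]/(g Q).
  have chp : p \in [pchar {poly 'F_p}] by rewrite pchar_poly pchar_Fp.
  have -> : g Q = \prod_x (g (period k) - (x%:P \Po g (period k)))
      - (g (period (k * p)) - g (period k)).
    rewrite /Q !rmorphB rmorph_prod; congr (_ - _); apply: eq_bigr => x _.
    by rewrite rmorphB rmorph_nat comp_polyC -{2}[x]natr_Zp rmorph_nat.
  have -> : g (period (k * p)) = g (period k) ^+ p.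
    rewrite -(pFrobenius_autE chp) /period !rmorph_sum; apply: eq_bigr => i _.
    rewrite /g /= !map_polyXn pFrobenius_autE -exprM; congr (_ ^+ _); exact: mulnAC.
  move: (g _) => c.
  have := finField_genPoly 'F_p; rewrite card_Fp // => /(congr1 (fun q => q \Po c)).
  rewrite rmorphB rmorph_prod rmorphXn /= comp_polyX => ->.
  apply/eqP; rewrite subr_eq0; apply/eqP; apply: eq_bigr => x _.
  by rewrite rmorphB /= comp_polyX.
have Pprod : P (phi (\prod_(x : 'F_p) (period k - (val x)%:R))).
  have := phi_mod_p Q0; rewrite rmorphB rmorphB.
  suff -> : phi (period (k * p)) = phi (period k) by rewrite subrr subr0.
  rewrite !phi_period; case: (f) f_gt0 f_order => // n _ n_ord.
  rewrite big_ord_recr [RHS]big_ord_recl [RHS]addrC; congr (_ + _).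
    by apply: eq_bigr => i _; rewrite /= -mulnA -expnS.
  apply/eqP; rewrite /= expn0 muln1 -mulnA -expnS (eq_prim_root_expr z_prim).
  by rewrite -modnMmr (eqP (_ : p ^ n.+1 == 1 %[mod N])) ?modnMmr ?muln1 // -n_ord.
have [x] := prime_ideal_prod Pprod.
by rewrite rmorphB rmorph_nat; exists (val x).
Qed.

Lemma sum_roots a : \sum_(k < N) z ^+ (k * a) = (N * (N %| a))%:R.
Proof.
have [dv|ndv] := boolP (N %| a)%N.
  rewrite muln1 (eq_bigr (fun=> 1)) ?sumr_const ?card_ord // => k _.
  by apply/eqP; rewrite -(prim_order_dvd z_prim) dvdn_mull.
rewrite muln0; under eq_bigr do rewrite mulnC exprM.
apply/eqP; move: ndv; rewrite (prim_order_dvd z_prim) => za.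
have := subrX1 (z ^+ a) N; rewrite -exprM mulnC exprM (prim_expr_order z_prim).
by rewrite expr1n subrr => /esym/eqP; rewrite mulf_eq0 subr_eq0 (negbTE za).
Qed.

Lemma decomposition_power (s : {rmorphism algC -> algC}) :
  stabilizes s P -> exists t, s z = z ^+ t /\ exists i, t * p ^ i = 1 %[mod N].
Proof.
move=> sP; have N_gt0 := prim_order_gt0 z_prim.
have [t co_t sz] := aut_prim_rootP s z_prim; exists t; split=> //.
have s_period k : s (phi (period k)) = phi (period (k * t)).
  rewrite !phi_period rmorph_sum; apply: eq_bigr => i _.
  by rewrite rmorphXn sz -exprM mulnCA mulnA.
have diffP k : P (phi (period (k * t)) - phi (period k)).
  have [n Pn] := period_rational k.
  have : P (s (phi (period k) - n%:R)) by apply/sP; exists (phi (period k) - n%:R).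
  rewrite rmorphB rmorph_nat s_period => Ps.
  have := PD Ps (PN Pn); rewrite opprB addrA; congr P.
  by rewrite subrK.
(* [N - 1] stands for the exponent -1: summing against [z ^+ (k * (N - 1))] detects the indices [i]
   with [a * p ^ i] equal to 1 modulo [N]. *)
pose b i a := (a * p ^ i + (N - 1))%N.
have sum_period a : \sum_(k < N) phi (period (k * a)) * z ^+ (k * (N - 1))
    = \sum_(i < f) (N * (a * p ^ i == 1 %[mod N]))%:R.
  under eq_bigr do rewrite phi_period mulr_suml.
  rewrite exchange_big; apply: eq_bigr => i _ /=.
  have <- : (N %| b i a)%N = (a * p ^ i == 1 %[mod N]).
    by rewrite /dvdn -[in LHS](mod0n N) -(eqn_modDr 1) /b -addnA subnK // add0n modnDr.
  by rewrite -sum_roots; apply: eq_bigr => k _; rewrite -exprD -mulnA -mulnDr.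
have Psum : P (\sum_(k < N) phi (period (k * t)) * z ^+ (k * (N - 1)) -
               \sum_(k < N) phi (period (k * 1)) * z ^+ (k * (N - 1))).
  rewrite -sumrB; apply: big_ind => // k _.
  by rewrite -mulrBl mulrC -phiXn muln1; apply: PM.
have [/existsP[i /eqP ti]|/existsPn none] :=
  boolP [exists i : 'I_f, t * p ^ i == 1 %[mod N]]; first by exists i.
(* Without such an [i] the sum for [t] is 0, and the sum for 1 is [N], coming from [i = 0] alone. So
   [P] contains both [N] and [p], and a Bezout relation puts 1 in [P]. *)
case: P1; move: Psum; rewrite !sum_period big1 => [|i _]; last first.
  by rewrite (negbTE (none i)) muln0.
rewrite (bigD1 (Ordinal f_gt0)) //= [X in _ - (_ + X)]big1 => [|i ni]; last first.
  rewrite mul1n -f_order gtnNdvd ?muln0 // lt0n.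
  by apply: contra ni => /eqP i0; apply/eqP/val_inj.
rewrite expn0 muln1 eqxx muln1 addr0 sub0r => /PN; rewrite opprK => PN1.
have [u u1] := coprimeP _ (prime_gt0 p_prime) p_co.
have -> : 1 = phi u.1%:R * p%:R + - (phi u.2%:R * N%:R) :> algC.
  rewrite !rmorph_nat -!natrM -natrB ?u1 //.
  by apply: ltnW; rewrite -subn_gt0 u1.
by apply: PD; [exact: PM | apply/PN/PM].
Qed.

End DecompositionGroup.

(** * Gaussian periods *)

Section GaussPeriods.

Variables (p : nat) (F : finFieldType) (charF : p \in [pchar F]).
Variable psi : F -> algC.
Hypothesis psiD : forall x y, psi (x + y) = psi x * psi y.
Hypothesis sum_psi : forall y, \sum_x psi (x * y) = (#|F| * (y == 0))%:R.
Hypothesis psiMn : forall x n, psi (x *+ n) = psi x ^+ n.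
Hypothesis psi_unity : forall x, psi x ^+ p = 1.
Hypothesis psi_frob : forall x, psi (x ^+ p) = psi x.

Variables (N : nat) (chi : {unit F} -> algC) (gamma : {unit F}).
Hypothesis chiM : forall u v, chi (u * v)%g = chi u * chi v.
Hypothesis gamma_gen : forall u, exists k, u = (gamma ^+ k)%g.
Local Notation z := (chi gamma).
Hypothesis z_prim : N.-primitive_root z.
Hypothesis p_co : coprime p N.
Hypothesis predp_co : coprime (p - 1) N.
Hypothesis N_odd : odd N.

Let p_prime : prime p. Proof. exact: pcharf_prime charF. Qed.

Definition gauss_period k := \sum_(u | chi u == z ^+ k) psi (val u).
Local Notation eta := gauss_period.

Lemma chi1 : chi 1%g = 1.
Proof.
have nz : chi 1%g != 0.
  apply/eqP => chi0; have := chiM 1%g gamma; rewrite mul1g chi0 mul0r => /eqP.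
  by rewrite (prim_root_eq0 z_prim) eqn0Ngt (prim_order_gt0 z_prim).
by apply: (mulfI nz); rewrite -chiM mulg1 mulr1.
Qed.

Lemma chiX u k : chi (u ^+ k)%g = chi u ^+ k.
Proof.
by elim: k => [|k IHk]; rewrite ?chi1 // expgS exprS chiM IHk.
Qed.

Lemma chi_unity u : chi u ^+ N = 1.
Proof.
have [k ->] := gamma_gen u.
by rewrite chiX exprAC (prim_expr_order z_prim) expr1n.
Qed.

Lemma chi_log u : {k : 'I_N | chi u = z ^+ k}.
Proof. exact: (prim_rootP z_prim (chi_unity u)). Qed.

(** Used for -1, with [n = 2], and for the elements of the prime field, with [n = p - 1]. *)
Lemma chi_eq1 u n : coprime n N -> (u ^+ n)%g = 1%g -> chi u = 1.
Proof.
move=> co un; have [k chiu] := chi_log u.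
have : (N %| k * n)%N.
  by rewrite (prim_order_dvd z_prim) exprM -chiu -chiX un chi1.
rewrite Gauss_dvdl 1?coprime_sym // => dv.
by apply/eqP; rewrite chiu -(prim_order_dvd z_prim).
Qed.

Lemma chiN1 (u : {unit F}) : val u = -1 -> chi u = 1.
Proof.
move=> u1; apply: (@chi_eq1 _ 2); first by rewrite coprime2n.
by apply/val_inj; rewrite FinRing.val_unitX u1 expr2 mulrNN mulr1.
Qed.

Lemma gauss_period_mod k : eta (k %% N) = eta k.
Proof. by rewrite /gauss_period (prim_expr_mod z_prim). Qed.

Lemma sum_unit (h : F -> algC) :
  \sum_(u : {unit F}) h (val u) = \sum_x h x - h 0.
Proof.
rewrite [X in _ = X - _](bigD1 0) //= addrAC subrr add0r.
rewrite [LHS](reindex_onto (fun x : F => insubd (1%g : {unit _}) x) val) /=.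
  apply: eq_big => [x|x nx].
    rewrite val_insubd unitfE.
    by have [->|_] := eqVneq x 0; rewrite ?eqxx //= oner_eq0.
  by rewrite (eqP nx).
by move=> u _; exact: valKd.
Qed.

Lemma psi_0 : psi 0 = 1. Proof. exact: psi_at0 sum_psi. Qed.

Lemma sum_psi_unit y : \sum_(u : {unit F}) psi (val u * y) = (#|F| * (y == 0))%:R - 1.
Proof. by rewrite (sum_unit (fun x => psi (x * y))) sum_psi mul0r psi_0. Qed.

Lemma partition_chi (h : {unit F} -> algC) :
  \sum_u h u = \sum_(k < N) \sum_(u | chi u == z ^+ k) h u.
Proof.
rewrite (partition_big (fun u => sval (chi_log u)) predT) //=.
apply: eq_bigr => k _; apply: eq_bigl => u.
case: (chi_log u) => l /= ->; rewrite (eq_prim_root_expr z_prim) !modn_small //.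
Qed.

Lemma sum_gauss_period : \sum_(k < N) eta k = -1.
Proof.
rewrite -partition_chi -[LHS](eq_bigr _ (fun _ _ => congr1 psi (mulr1 _))).
by rewrite sum_psi_unit oner_eq0 muln0 sub0r.
Qed.

Lemma gauss_sum_period : \sum_u chi u * psi (val u) = \sum_(k < N) z ^+ k * eta k.
Proof.
rewrite partition_chi; apply: eq_bigr => k _.
by rewrite mulr_sumr; apply: eq_bigr => u /eqP ->.
Qed.

(** The Frobenius map permutes the units, preserves [psi] and multiplies the exponent of [chi] by
    [p], which is invertible modulo [N]. *)
Lemma gauss_period_frob k : eta (k * p) = eta k.
Proof.
have inj : injective (fun u : {unit F} => u ^+ p)%g.
  move=> u v /(congr1 val); rewrite !FinRing.val_unitX => /eqP.
  rewrite -subr_eq0 -(pFrobenius_autE charF) -pFrobenius_autE -rmorphB.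
  by rewrite fmorph_eq0 subr_eq0 => /eqP/val_inj.
rewrite /gauss_period (reindex_inj inj); apply: eq_big => [u|u _]; last first.
  by rewrite FinRing.val_unitX psi_frob.
have zp_prim : N.-primitive_root (z ^+ p).
  by rewrite (prim_root_exp_coprime _ z_prim).
rewrite chiX; have [j ->] := chi_log u.
rewrite -exprM [(j * p)%N]mulnC [(k * p)%N]mulnC !exprM.
by rewrite !(eq_prim_root_expr zp_prim, eq_prim_root_expr z_prim).
Qed.

Lemma gauss_period_Aint k : eta k \in Aint.
Proof.
apply: rpred_sum => u _; apply: (Aint_unity_root (prime_gt0 p_prime)).
exact/unity_rootP/psi_unity.
Qed.

(** Multiplication by [c] in the prime field preserves the classes of [chi] and raises [psi] to the
    power [c]. Summing over [1 <= c < p] shows that [(p - 1)] times the period is an integer, and a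
    rational algebraic integer is an integer. *)
Lemma gauss_period_int k : eta k \in Num.int.
Proof.
have eta_c c : (1 <= c < p)%N -> eta k = \sum_(u | chi u == z ^+ k) psi (val u) ^+ c.
  case/andP=> c0 cp; have nc : (c%:R : F) != 0.
    by rewrite -(dvdn_pcharf charF) gtnNdvd.
  have cU : (c%:R : F) \is a GRing.unit by rewrite unitfE.
  pose v : {unit F} := Sub (c%:R : F) cU.
  have chiv : chi v = 1.
    apply: (chi_eq1 predp_co); apply/val_inj; rewrite FinRing.val_unitX /=.
    apply: (mulfI nc); rewrite -exprS subn1 prednK ?prime_gt0 // mulr1.
    exact: (pFrobenius_aut_nat charF).
  rewrite /gauss_period (reindex_inj (mulgI v)).
  apply: eq_big => u; first by rewrite chiM chiv mul1r.
  by rewrite -psiMn -mulr_natl.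
have eta_sum : eta k *+ (p - 1) \in Num.int.
  rewrite -(sumr_const_nat p 1) (eq_big_nat _ _ eta_c) exchange_big.
  apply: rpred_sum => u _ /=.
  have -> : \sum_(1 <= c < p) psi (val u) ^+ c = \sum_(c < p) psi (val u) ^+ c - 1.
    by rewrite -(big_mkord xpredT (fun c => psi (val u) ^+ c)) big_ltn ?prime_gt0 // addrAC subrr add0r.
  rewrite rpredB ?rpred1 //.
  have [->|ny] := eqVneq (psi (val u)) 1.
    by apply: rpred_sum => c _; rewrite expr1n rpred1.
  have := subrX1 (psi (val u)) p; rewrite psi_unity subrr => /esym/eqP.
  by rewrite mulf_eq0 subr_eq0 (negbTE ny) => /eqP ->; rewrite rpred0.
apply: Cint_rat_Aint (gauss_period_Aint k).
have np : (p - 1)%:R != 0 :> algC by rewrite pnatr_eq0 -lt0n subn_gt0 prime_gt1.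
rewrite -(mulfK np (eta k)) mulr_natr rpred_div ?rpred_nat //.
by case/intrP: eta_sum => n ->; rewrite rpred_int.
Qed.

Lemma sum_chi : (1 < N)%N -> \sum_u chi u = 0.
Proof.
move=> N_gt1; have z1 : z != 1 by rewrite -(expr1 z) -(prim_order_dvd z_prim) gtnNdvd.
apply/eqP; have : z * (\sum_u chi u) == \sum_u chi u.
  by rewrite mulr_sumr [eqbRHS](reindex_inj (mulgI gamma)); apply/eqP/eq_bigr => u _; rewrite chiM.
by rewrite -subr_eq0 -{2}[\sum_u _]mul1r -mulrBl mulf_eq0 subr_eq0 (negbTE z1).
Qed.

(** The left side is the complex conjugate of the Gauss sum; the sign in [psi] is absorbed because
    [chi] is 1 at -1. *)
Lemma gauss_sum_conj :
  \sum_u (chi u)^-1 * psi (- val u) = \sum_(k < N) z ^- k * eta k.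
Proof.
have N1U : (-1 : F) \is a GRing.unit by rewrite unitrN1.
pose v : {unit F} := Sub (-1 : F) N1U.
rewrite (reindex_inj (mulgI v)) partition_chi; apply: eq_bigr => k _.
rewrite mulr_sumr; apply: eq_bigr => u /eqP chiu.
by rewrite chiM (chiN1 (erefl : val v = -1)) mul1r chiu /= mulN1r opprK.
Qed.

(** After the substitution [u = t * v], the sum over [v] is -1 except for the extra [#|F|] at
    [t = 1]; the terms -1 cancel since [chi] sums to 0. *)
Lemma gauss_sum_norm : (1 < N)%N ->
  (\sum_u chi u * psi (val u)) * (\sum_u (chi u)^-1 * psi (- val u)) = #|F|%:R.
Proof.
move=> N_gt1; have nz u : chi u != 0.
  apply/eqP => chi0; have := chi_unity u; rewrite chi0 expr0n (gtn_eqF (ltnW N_gt1)).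
  by move/eqP; rewrite eq_sym oner_eq0.
rewrite mulr_sumr.
transitivity (\sum_(v : {unit F}) \sum_(t : {unit F}) chi t * psi ((val v) * (val t - 1))).
  apply: eq_bigr => v _; rewrite mulr_suml [LHS](reindex_inj (mulIg v)).
  apply: eq_bigr => t _; have -> : val v * (val t - 1) = val (t * v)%g - val v.
    by rewrite mulrBr mulr1 [_ * val t]mulrC.
  by rewrite psiD chiM; field; exact: nz.
rewrite exchange_big /=.
under eq_bigr do rewrite -mulr_sumr sum_psi_unit mulrBr mulr1.
rewrite sumrB sum_chi // subr0 (bigD1 1%g) //= chi1 mul1r subrr eqxx muln1.
rewrite big1 ?addr0 // => t nt; rewrite subr_eq0.
case: eqP => [t1|_]; last by rewrite muln0 mulr0.
by case/eqP: nt; apply/val_inj.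
Qed.

(** Multiplication by [v] shifts the classes making up [D] by [a]; [M <= N] keeps these classes
    distinct, so that no unit is counted twice. *)
Lemma char_sum_period (M : nat) (D : {set F}) (v : {unit F}) a :
    (M <= N)%N -> 0 \notin D ->
    (forall u : {unit F}, (val u \in D) = [exists i : 'I_M, chi u == z ^+ i]) ->
  chi v = z ^+ a -> char_sum psi D (val v) = \sum_(i < M) eta (a + i).
Proof.
move=> leMN D0 memD chiv.
have nz k : z ^+ k != 0.
  by rewrite expf_neq0 // (prim_root_eq0 z_prim) -lt0n (prim_order_gt0 z_prim).
rewrite /char_sum big_mkcond /=.
have := sum_unit (fun d => if d \in D then psi (d * val v) else 0).
rewrite (negbTE D0) subr0 => <-.
rewrite -big_mkcond (eq_bigl (fun u => [exists i : 'I_M, chi u == z ^+ i])) //.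
pose h (u : {unit F}) i := if chi u == z ^+ (i : 'I_M) then psi (val u * val v) else 0.
transitivity (\sum_u \sum_(i < M) h u i).
  rewrite big_mkcond; apply: eq_bigr => u _.
  case: existsP => [[i /eqP ui]|none].
    rewrite (bigD1 i) //= /h ui eqxx big1 ?addr0 // => j nj.
    rewrite (eq_prim_root_expr z_prim) !modn_small; last 2 first.
    - exact: leq_trans (ltn_ord j) leMN.
    - exact: leq_trans (ltn_ord i) leMN.
    by rewrite (inj_eq val_inj) eq_sym (negbTE nj).
  rewrite big1 // => i _; rewrite /h; case: ifP => // ui.
  by case: none; exists i.
rewrite exchange_big; apply: eq_bigr => i _ /=.
rewrite /h -big_mkcond /gauss_period [RHS](reindex_inj (mulIg v)) /=.
apply: eq_bigl => u; rewrite chiM chiv exprD [z ^+ a * _]mulrC.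
by rewrite (inj_eq (mulIf (nz a))).
Qed.

End GaussPeriods.

(** * Windows of periods and sums over F_p1 *)

Lemma sum_ord_mul (V : nmodType) (h : nat -> V) M n :
  \sum_(k < M * n) h k = \sum_(c < n) \sum_(i < M) h (M * c + i)%N.
Proof.
elim: n => [|n IHn]; first by rewrite muln0 !big_ord0.
rewrite big_ord_recr -IHn /= -!(big_mkord xpredT h) mulnSr.
rewrite (big_cat_nat (n := M * n)) ?leq_addr //=; congr (_ + _).
rewrite -[X in \sum_(X <= _ < _) _]add0n big_addn addKn big_mkord.
by apply: eq_bigr => i _; rewrite addnC.
Qed.

Section Windows.

Variables (V : zmodType) (h : nat -> V) (M : nat).
Hypothesis M_gt0 : (0 < M)%N.
Hypothesis h_shift : forall k, ~~ (M %| k)%N -> h (k + M) = h k.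

Lemma shift_mul c i : ~~ (M %| i)%N -> h (M * c + i) = h i.
Proof.
move=> ndv; elim: c => [|c IHc]; first by rewrite muln0.
rewrite mulnS -addnA addnC h_shift ?IHc //.
by rewrite dvdn_addr // dvdn_mulr.
Qed.

(** Moving a window of length [M] from [b] to [b + 1] replaces [h b] by [h (b + M)], which changes
    nothing unless [M] divides [b]. So every window may be pushed to a multiple of [M], where only
    its first term depends on the position. *)
Lemma window_sum : exists C, (forall c, \sum_(i < M) h (M * c + i)%N = C + h (M * c)%N)
  /\ forall a, exists c, \sum_(i < M) h (a + i)%N = C + h (M * c)%N.
Proof.
pose C := \sum_(i < M | (i : nat) != 0%N) h i; exists C.
have mulP c : \sum_(i < M) h (M * c + i)%N = C + h (M * c)%N.
  rewrite (bigD1 (Ordinal M_gt0)) //= addn0 addrC; congr (_ + _).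
  apply: eq_big => [i|i ni]; first by rewrite -val_eqE.
  by apply: shift_mul; rewrite gtnNdvd // lt0n -[_ == _]/(i == Ordinal M_gt0).
split=> // a.
have step b : ~~ (M %| b)%N -> \sum_(i < M) h (b.+1 + i)%N = \sum_(i < M) h (b + i)%N.
  move=> ndv; case: (M) h_shift ndv => [_ _|M' shift ndv]; first by rewrite !big_ord0.
  rewrite big_ord_recr [RHS]big_ord_recl /= addn0 -(shift _ ndv) addrC addSnnS.
  by congr (_ + _); apply: eq_bigr => i _; rewrite /= addSnnS.
(* Induction on a distance to a later multiple of [M]; this distance is [M], not 0, if [a] is itself
   a multiple, and the induction then stops at once. *)
have : (M %| a + (M - a %% M))%N.
  by rewrite /dvdn -modnDml addnC subnK ?modnn // ltnW // ltn_mod.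
move: (M - _)%N => n; elim: n a => [|n IHn] a dv.
  by move: dv; rewrite addn0 => /dvdnP[c ->]; exists c; rewrite mulnC mulP.
have [/dvdnP[c ->]|ndv] := boolP (M %| a)%N; first by exists c; rewrite mulnC mulP.
by rewrite -step //; apply: IHn; rewrite addSnnS.
Qed.

Lemma sum_multiples n : \sum_(k < M * n) h k =
  \sum_(c < n) h (M * c)%N + (\sum_(i < M | (i : nat) != 0%N) h i) *+ n.
Proof.
rewrite sum_ord_mul exchange_big (bigD1 (Ordinal M_gt0)) //=.
under eq_bigr do rewrite addn0; congr (_ + _).
rewrite -sumrMnl; apply: eq_big => [i|i ni]; first by rewrite -val_eqE.
rewrite -[X in _ *+ X](card_ord n) -sumr_const; apply: eq_bigr => c _.
by apply: shift_mul; rewrite gtnNdvd // lt0n -[_ == _]/(i == Ordinal M_gt0).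
Qed.

End Windows.

(** For a residue [i] nonzero modulo [M] the values of [h] are constant and factor out a full
    geometric sum in [z ^+ M], which is 0. *)
Lemma root_sum_multiples (R : idomainType) (h : nat -> R) (M n : nat) (z : R) :
    (0 < M)%N -> (forall k, ~~ (M %| k)%N -> h (k + M)%N = h k) ->
    z ^+ M != 1 -> z ^+ (M * n) = 1 ->
  \sum_(k < M * n) z ^+ k * h k = \sum_(c < n) (z ^+ M) ^+ c * h (M * c)%N.
Proof.
move=> M_gt0 h_shift zM zMn.
rewrite (sum_ord_mul (fun k => z ^+ k * h k)) exchange_big (bigD1 (Ordinal M_gt0)) //=.
under eq_bigr do rewrite addn0 exprM.
rewrite [X in _ + X]big1 ?addr0 // => i ni.
have ndv : ~~ (M %| i)%N.
  by rewrite gtnNdvd // lt0n -[_ == _]/(i == Ordinal M_gt0).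
under eq_bigr do rewrite exprD (shift_mul h_shift) // exprM -mulrA.
rewrite -mulr_suml; have := subrX1 (z ^+ M) n; rewrite -exprM zMn subrr.
by move/esym/eqP; rewrite mulf_eq0 subr_eq0 (negbTE zM) => /eqP ->; rewrite mul0r.
Qed.

(** * Fourier analysis of integer-valued functions on a prime field *)

Section PrimeFieldSums.

Variables (q : nat) (om : algC).
Hypothesis q_prime : prime q.
Hypothesis om_prim : q.-primitive_root om.

Lemma sum_Fp (V : nmodType) (h : nat -> V) :
  \sum_(c : 'F_q) h (val c) = \sum_(c < q) h c.
Proof. by rewrite -!(big_mkord xpredT h) Fp_cast. Qed.

Definition Fp_char (c : 'F_q) : algC := om ^+ val c.
Local Notation e := Fp_char.

Lemma Fp_char_nat n : e n%:R = om ^+ n.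
Proof. by rewrite /e /= val_Fp_nat // (prim_expr_mod om_prim). Qed.

Lemma Fp_charD a b : e (a + b) = e a * e b.
Proof. by rewrite -[a]natr_Zp -[b]natr_Zp -natrD !Fp_char_nat exprD. Qed.

Lemma Fp_charM a b : e (a * b) = e a ^+ val b.
Proof. by rewrite -[a]natr_Zp -{1}[b]natr_Zp -natrM !Fp_char_nat exprM. Qed.

Lemma Fp_char_unity c : e c ^+ q = 1.
Proof. by rewrite /e exprAC (prim_expr_order om_prim) expr1n. Qed.

Lemma Fp_char_Aint c : e c \in Aint.
Proof. by rewrite rpredX // (Aint_prim_root om_prim). Qed.

Lemma sum_Fp_char y : \sum_x e (x * y) = (#|'F_q| * (y == 0))%:R.
Proof.
have [-> | ny] := eqVneq y 0.
  rewrite (eq_bigr (fun=> 1)) ?sumr_const ?muln1 // => x _.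
  by rewrite mulr0 /e expr0.
rewrite muln0 (reindex_inj (mulIf (invr_neq0 ny))) /=.
under eq_bigr do rewrite mulfVK //.
rewrite (sum_Fp (fun c => om ^+ c)); have := subrX1 om q.
rewrite (prim_expr_order om_prim) subrr => /esym/eqP.
rewrite mulf_eq0 subr_eq0 -{1}(expr1 om) -(prim_order_dvd om_prim).
by rewrite gtnNdvd ?prime_gt1 //= => /eqP.
Qed.

Variable beta : 'F_q -> int.

Definition Fp_fourier j := \sum_c (beta c)%:~R * e (c * j).
Local Notation G := Fp_fourier.

(** The automorphism raising [q]-th roots of unity to the power [j] fixes the integers [beta c];
    hence all values of [G] at nonzero frequencies are conjugate. *)
Lemma Fp_aut (j : 'F_q) : j != 0 ->
  exists u : {rmorphism algC -> algC}, (forall k, u (G k) = G (k * j)).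
Proof.
move=> nj; have co : coprime (val j) q.
  rewrite coprime_sym prime_coprime // gtnNdvd ?lt0n //.
  by rewrite -[ltnRHS](Fp_cast q_prime) ltn_ord.
have [u Du] := Qn_aut_exists co; exists u => k.
rewrite rmorph_sum; apply: eq_bigr => c _.
by rewrite rmorphM rmorph_int Du ?Fp_char_unity // -Fp_charM mulrA.
Qed.

Lemma Fp_fourier0 : G 0 = (\sum_c beta c)%:~R.
Proof.
rewrite rmorph_sum; apply: eq_bigr => c _.
by rewrite mulr0 /e expr0 mulr1.
Qed.

Lemma Fp_fourier_inv x : \sum_y e (- x * y) * G y = q%:R * (beta x)%:~R.
Proof.
have := fourier_inversion Fp_charD sum_Fp_char (fun c => (beta c)%:~R) x.
by rewrite card_Fp.
Qed.

(** Parseval's identity: the [q - 1] nonzero frequencies each contribute [n] by conjugacy, and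
    frequency 0 contributes the square of the sum. *)
Lemma Fp_parseval (n : nat) : G 1 * G (-1) = n%:R ->
  (q%:Z - 1) * n%:Z + (\sum_c beta c) ^+ 2 = q%:Z * \sum_c beta c ^+ 2.
Proof.
move=> G1; have Gj j : j != 0 -> G j * G (- j) = n%:R.
  move=> /Fp_aut[u uG]; have -> : G j = u (G 1) by rewrite uG mul1r.
  have -> : G (- j) = u (G (-1)) by rewrite uG mulN1r.
  by rewrite -rmorphM G1 rmorph_nat.
apply: (@intr_inj algC); rewrite rmorphD !rmorphM rmorphB /= -!Fp_fourier0.
rewrite -!pmulrn; transitivity (\sum_j G j * G (- j)).
  rewrite (bigD1 0) //= oppr0 addrC; congr (_ + _).
  rewrite (eq_bigr (fun=> n%:R)) // sumr_const.
  have -> : #|[pred j : 'F_q | j != 0]| = (q - 1)%N.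
    by have := cardC1 (0 : 'F_q); rewrite card_Fp // subn1.
  by rewrite -[RHS]mulr_natl natrB ?prime_gt0.
rewrite rmorph_sum mulr_sumr.
under eq_bigr do rewrite mulr_sumr.
rewrite exchange_big; apply: eq_bigr => c _ /=.
under eq_bigr do rewrite mulrCA mulrN -mulNr [G _ * _]mulrC.
by rewrite -mulr_sumr Fp_fourier_inv rmorphXn /=; ring.
Qed.

Lemma Fp_fourier_dvd (d : nat) : (0 < d)%N -> coprime d q -> beta 0 = 0 ->
  d%:R^-1 * G 1 \in Aint -> forall c, (d%:Z %| beta c)%Z.
Proof.
move=> d_gt0 co_d beta0 Gint c.
have nd : d%:R != 0 :> algC by rewrite pnatr_eq0 -lt0n.
have : d%:R^-1 * (q%:R * (beta c)%:~R) \in (Num.int : {pred algC}).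
  apply: Cint_rat_Aint.
    by rewrite rpredM ?rpredV ?rpred_nat // rpredM ?rpred_nat ?rpred_int.
  (* Since [beta 0 = 0], the inversion formula may use [e (- c * j) - 1] as kernel. This removes the
     frequency 0, the only one not conjugate to [G 1], so divisibility of [G 1] by [d] suffices. *)
  have S0 : \sum_j G j = 0.
    have := Fp_fourier_inv 0; rewrite beta0 mulr0z mulr0 => inv0; rewrite -[RHS]inv0.
    by apply: eq_bigr => j _; rewrite oppr0 mul0r /e expr0 mul1r.
  have -> : q%:R * (beta c)%:~R = \sum_j (e (- c * j) - 1) * G j.
    under eq_bigr do rewrite mulrBl mul1r.
    by rewrite sumrB Fp_fourier_inv S0 subr0.
  rewrite mulr_sumr; apply: rpred_sum => j _; rewrite mulrCA.
  have [-> | /Fp_aut[u uG]] := eqVneq j 0.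
    by rewrite mulr0 /e expr0 subrr mul0r.
  apply: rpredM; first by rewrite rpredB ?rpred1 ?Fp_char_Aint.
  have -> : G j = u (G 1) by rewrite uG mul1r.
  by rewrite -(rmorph_nat u d) -fmorphV -rmorphM Aint_aut.
case/intrP => n En.
rewrite -(Gauss_dvdzr _ (_ : coprimez d%:Z q%:Z)) //.
apply/dvdzP; exists n; apply: (@intr_inj algC).
by rewrite !rmorphM /= -En -!pmulrn; field.
Qed.

(** Every [G j] is [b] times a sum of roots of unity, so [n / b ^+ 2] is a rational algebraic
    integer. *)
Lemma Fp_fourier_sqr_dvd (n : nat) (b : int) : b != 0 ->
    (forall c, beta c = 0 \/ beta c = b) -> G 1 * G (-1) = n%:R ->
  (b ^+ 2 %| n%:Z)%Z.
Proof.
move=> nb two G1.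
have nbC : b%:~R != 0 :> algC by rewrite intr_eq0.
pose X j := \sum_(c | beta c != 0) e (c * j).
have GE j : G j = b%:~R * X j.
  rewrite mulr_sumr [RHS]big_mkcond /=; apply: eq_bigr => c _.
  by case: eqVneq => [->|n0]; rewrite ?mul0r //; case: (two c) n0 => ->; rewrite ?eqxx.
have Xint j : X j \in Aint by apply: rpred_sum => c _; exact: Fp_char_Aint.
have XE : X 1 * X (-1) = n%:R / b%:~R ^+ 2.
  by rewrite -G1 !GE; field.
have /intrP[k kE] : X 1 * X (-1) \in (Num.int : {pred algC}).
  apply: Cint_rat_Aint; last exact: rpredM.
  by rewrite XE rpred_div ?rpredX ?rpred_nat ?rpred_int.
apply/dvdzP; exists k; apply: (@intr_inj algC).
by rewrite rmorphM rmorphXn /= -kE XE mulfVK ?expf_neq0.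
Qed.

End PrimeFieldSums.

(** * Integer inequalities and the arithmetic form of the two conditions *)

Lemma sum_Fp_nz (q : nat) (V : zmodType) (h : 'F_q -> V) :
  h 0 = 0 -> \sum_(c | c != 0) h c = \sum_c h c.
Proof. by move=> h0; rewrite [RHS](bigD1 0) //= h0 add0r. Qed.

Lemma ler_sqr_int (n : int) : n <= n ^+ 2.
Proof. by rewrite expr2; nia. Qed.

Lemma sqr_int_eq (n : int) : n ^+ 2 = n -> n = 0 \/ n = 1.
Proof. by rewrite expr2; nia. Qed.

Lemma multiple_sqrD_le0 (e : nat) (t : int) :
  (1 < e)%N -> (e%:Z %| t)%Z -> t ^+ 2 + t <= 0 -> t = 0.
Proof.
rewrite expr2 => e_gt1 dv le; have [t0|] : t = 0 \/ t = -1 by nia.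
  exact: t0.
by move=> t1; move: dv; rewrite t1 dvdzE /= dvdn1 gtn_eqF.
Qed.

(* With T the sum of the alpha c and t the integer such that                  *)
(* eps * T = L + q * t, the translates eps * alpha c - t, for c != 0, have sum *)
(* L + t and sum of squares L - t ^ 2.  As x <= x ^ 2 on the integers, t is 0 *)
(* or -1, and e, which divides t, excludes -1.                                *)
Lemma two_valued_of_moments (q e w : nat) (alpha : 'F_q -> int) (L eps : int) :
    prime q -> (1 < e)%N -> (e * w = q - 1)%N -> alpha 0 = 0 ->
    eps = 1 \/ eps = -1 ->
    (e%:Z %| (\sum_c alpha c)%R)%Z -> (e%:Z %| L)%Z ->
    (q%:Z %| (\sum_c alpha c - eps * L)%R)%Z ->
    q%:Z * \sum_c alpha c ^+ 2 - (\sum_c alpha c) ^+ 2 = q%:Z * L - L ^+ 2 ->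
  forall c, alpha c = 0 \/ alpha c = eps.
Proof.
move=> q_pr e_gt1 ew alpha0 epsP dvT dvL; set T := \sum_c _; set U := \sum_c _.
move=> /dvdzP[t0 Tt0] moments.
have eps2 : eps ^+ 2 = 1 by case: epsP => ->.
have q0 : q%:Z != 0 by rewrite -lt0n prime_gt0.
pose t := eps * t0.
have Tt : eps * T = L + q%:Z * t.
  have -> : T = eps * L + t0 * q%:Z by rewrite -Tt0 addrC subrK.
  by rewrite mulrDr mulrA -expr2 eps2 /t; ring.
have T2 : T ^+ 2 = (L + q%:Z * t) ^+ 2 by rewrite -Tt exprMn eps2 mul1r.
have Ut : U = L + 2 * L * t + q%:Z * t ^+ 2.
  apply: (mulfI q0); apply/eqP; rewrite -subr_eq0.
  by move/eqP: moments; rewrite T2 -subr_eq0; congr (_ == _); ring.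
(* [q] is 1 modulo [e], so [t] is congruent to [eps * T - L]. *)
have dvt : (e%:Z %| t)%Z.
  have qE : q%:Z = e%:Z * w%:Z + 1 by rewrite -PoszM ew -[1]/(1%:Z) -PoszD subnK ?prime_gt0.
  have -> : t = eps * T - L - e%:Z * (w%:Z * t) by rewrite Tt qE; ring.
  by rewrite rpredB ?dvdz_mulr // rpredB // dvdz_mull.
have cardF : #|[pred c : 'F_q | c != 0]| = (q - 1)%N.
  by have := cardC1 (0 : 'F_q); rewrite card_Fp // subn1.
have sumF (k : int) : \sum_(c : 'F_q | c != 0) k = k * (q%:Z - 1).
  by rewrite sumr_const cardF -mulr_natr natz -subzn ?prime_gt0.
pose x c := eps * alpha c - t.
have x_ge0 c : 0 <= x c ^+ 2 - x c by rewrite subr_ge0 ler_sqr_int.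
have sumx : \sum_(c | c != 0) (x c ^+ 2 - x c) = - (t ^+ 2 + t).
  have -> : \sum_(c | c != 0) (x c ^+ 2 - x c) =
      \sum_(c : 'F_q | c != 0) alpha c ^+ 2 - (2 * t + 1) * (eps * \sum_(c : 'F_q | c != 0) alpha c)
      + \sum_(c : 'F_q | c != 0) (t ^+ 2 + t).
    rewrite !mulr_sumr -sumrB -big_split; apply: eq_bigr => c _.
    by rewrite /x sqrrB exprMn eps2 /=; ring.
  rewrite sumF !sum_Fp_nz // -/T -/U ?alpha0 ?expr0n //.
  by rewrite Tt Ut; ring.
have t0E : t = 0.
  apply: (multiple_sqrD_le0 e_gt1 dvt).
  by rewrite -oppr_ge0 -sumx sumr_ge0.
have /psumr_eq0P x0 : forall c : 'F_q, c != 0 -> 0 <= x c ^+ 2 - x c by [].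
move=> c; have [->|nc] := eqVneq c 0; first by left.
have : x c ^+ 2 = x c.
  by apply/eqP; rewrite -subr_eq0 x0 // sumx t0E expr0n addr0 oppr0.
have -> : alpha c = eps * x c by rewrite /x t0E subr0 mulrA -expr2 eps2 mul1r.
by case/sqr_int_eq => ->; rewrite ?mulr0 ?mulr1; [left | right].
Qed.

(** The integer quotient in the congruence is exact, because [w] divides [p1 - 1]. *)
Lemma int_divz_factor (a p1 e w l : nat) : (0 < w)%N -> (e * w = p1 - 1)%N -> (0 < p1)%N ->
  ((a%:Z * (1 - p1%:Z) * l%:Z) %/ w%:Z)%Z = - (a%:Z * (e * l)%N%:Z).
Proof.
move=> w_gt0 ew p1_gt0; have -> : 1 - p1%:Z = - (e%:Z * w%:Z).
  by rewrite -PoszM ew -subzn // opprB.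
have -> : a%:Z * - (e%:Z * w%:Z) * l%:Z = - (a%:Z * (e * l)%N%:Z) * w%:Z.
  by rewrite PoszM; ring.
by rewrite mulzK // -lt0n.
Qed.

(** Multiplying by [(p1 - 1) * p ^ (2 * r)] clears the denominators and the possibly negative
    exponent, since [(p1 - 1) * l / w] is the integer [e * l]. The result is the moment identity for
    [e * l] values equal to plus or minus [p ^ r], the others being 0. *)
Lemma power_identity_int (p p1 e w f r l : nat) :
    (0 < p)%N -> (0 < e)%N -> (0 < w)%N -> (0 < p1)%N -> (e * w = p1 - 1)%N ->
  (p%:Q ^ (f%:Z - 2 * r%:Z) = l%:Q / w%:Q * (p1%:Q - (p1%:Q - 1) * l%:Q / w%:Q))
  <-> (p1%:Z - 1) * (p ^ f)%N%:Z
      = (p ^ r)%N%:Z ^+ 2 * (p1%:Z * (e * l)%N%:Z - (e * l)%N%:Z ^+ 2).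
Proof.
move=> p_gt0 e_gt0 w_gt0 p1_gt0 ew.
have nz n : (0 < n)%N -> n%:Q != 0 by move=> n0; rewrite intr_eq0 -lt0n.
have [np ne nw] := And3 (nz _ p_gt0) (nz _ e_gt0) (nz _ w_gt0).
have p1E : p1%:Q = e%:Q * w%:Q + 1.
  by rewrite -[p1 in LHS](subnK p1_gt0) -ew PoszD PoszM rmorphD rmorphM.
have -> : p%:Q ^ (f%:Z - 2 * r%:Z) = p%:Q ^+ f / (p%:Q ^+ r) ^+ 2.
  have -> : 2 * r%:Z = (r * 2)%N%:Z by rewrite PoszM mulrC.
  by rewrite expfzDr // -invr_expz -exprM.
have nR : p%:Q ^+ r != 0 by rewrite expf_neq0.
set P := p%:Q ^+ f; set R := p%:Q ^+ r in nR *.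
have intE : ((p1%:Z - 1) * (p ^ f)%N%:Z
    = (p ^ r)%N%:Z ^+ 2 * (p1%:Z * (e * l)%N%:Z - (e * l)%N%:Z ^+ 2)) <->
    (p1%:Q - 1) * P = R ^+ 2 * (p1%:Q * (e%:Q * l%:Q) - (e%:Q * l%:Q) ^+ 2).
  split=> [/(congr1 (intr : int -> rat))|E].
    by rewrite !(rmorphM, rmorphB, rmorphXn) /=.
  apply: (@intr_inj rat).
  by rewrite !(rmorphM, rmorphB, rmorphXn) /=.
rewrite intE p1E; split=> [E|E].
  have -> : P = P / R ^+ 2 * R ^+ 2 by rewrite mulfVK // expf_neq0.
  by rewrite E; field.
have -> : P = (e%:Q * w%:Q + 1 - 1) * P / (e%:Q * w%:Q) by field; rewrite !pnatr_eq0 -!lt0n w_gt0 e_gt0.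
by rewrite E; field; rewrite nR !pnatr_eq0 -!lt0n w_gt0 e_gt0.
Qed.

(** * The eigenvalues of the graph and the Gauss sum *)

Section StrongRegularity.

Variables (p1 m N p f w : nat).
Hypothesis p1_prime : prime p1.
Hypothesis m_ge1 : (1 <= m)%N.
Hypothesis N_def : N = (p1 ^ m)%N.
Hypothesis p_prime : prime p.
Hypothesis f_def : f = #[unit_mod N p%:Z]%g.
Hypothesis w_def : w = (totient N %/ f)%N.
Variables (F : finFieldType) (charF : p \in [pchar F]).
Hypothesis card_F : #|F| = (p ^ f)%N.
Hypothesis Nm1_notin : unit_mod N (-1) \notin <[unit_mod N p%:Z]>%g.
Hypothesis coprime_N : gcdn (p * (p - 1)) N = 1%N.
Hypothesis w_dvd : (w %| p1 - 1)%N.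
Variable xi_p : algC.
Hypothesis xi_p_prim : p.-primitive_root xi_p.
Variable xi_N : algC.
Hypothesis xi_N_prim : N.-primitive_root xi_N.
Variable chi : 'CF([set: {unit F}]).
Hypothesis chi_char : chi \is a linear_char.
Hypothesis chi_order : #[chi]%CF = N.
Variable r : nat.
Hypothesis r_dvd : in_decomposition_int N p xi_N
  (p%:R ^- r * gauss_sum charF xi_p chi).
Variable gamma : {unit F}.
Hypothesis gamma_prim : generator [set: {unit F}] gamma.
Variable D : {set F}.
Hypothesis D_def : D = (\bigcup_(i < p1 ^ (m - 1)) cyclotomic_class gamma N i)%SET.

Local Notation M := (p1 ^ (m - 1))%N.
Local Notation e := ((p1 - 1) %/ w)%N.
Local Notation psi := (Defs.add_char charF xi_p).
Local Notation z := (chi gamma).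
Local Notation om := (z ^+ M).

Let N_gt1 : (1 < N)%N. Proof. exact: modulus_gt1 p1_prime m_ge1 N_def. Qed.
Let NE : N = (M * p1)%N. Proof. by rewrite (modulusE m_ge1 N_def) mulnC. Qed.
Let M_gt0 : (0 < M)%N. Proof. by rewrite expn_gt0 prime_gt0. Qed.
Let p_co : coprime p N. Proof. exact: coprime_p_N coprime_N. Qed.
Let predp_co : coprime (p - 1) N. Proof. exact: coprime_predp_N coprime_N. Qed.
Let N_odd : odd N.
Proof.
by rewrite N_def oddX (odd_p1 p1_prime m_ge1 N_def p_prime coprime_N) orbT.
Qed.

Lemma chi_mul u v : chi (u * v)%g = chi u * chi v.
Proof. by rewrite lin_charM ?inE. Qed.

Lemma gamma_gen u : exists k, u = (gamma ^+ k)%g.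
Proof.
have : u \in <[gamma]>%g by rewrite -(eqP gamma_prim) inE.
by case/cycleP=> k; exists k.
Qed.

Lemma chi_gamma_prim : N.-primitive_root z.
Proof.
have zN : z ^+ N = 1.
  by apply: (dvdn_cforderP (n := N) _); rewrite ?chi_order ?inE.
have [n zn dv] := prim_order_exists (ltnW N_gt1) zN.
suff : (N %| n)%N by move=> dv'; rewrite (eqP (_ : N == n)) // eqn_dvd dv dv'.
rewrite -chi_order; apply/dvdn_cforderP => u _.
have [k ->] := gamma_gen u.
by rewrite lin_charX ?inE // exprAC (prim_expr_order zn) expr1n.
Qed.
Let z_prim := chi_gamma_prim.

Let psiD := add_charD charF xi_p_prim.
Let psi_sum := sum_add_char charF xi_p_prim.
Let psiMn := add_charMn charF xi_p_prim.
Let psi_unity := add_char_unity charF xi_p_prim.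
Let psi_frob := add_char_frob charF xi_p.

Local Notation eta := (gauss_period psi chi gamma).
Definition period_int k : int := Num.floor (eta k).

Lemma period_intE k : (period_int k)%:~R = eta k.
Proof.
apply: floorK; exact: (gauss_period_int charF psiMn psi_unity chi_mul gamma_gen z_prim predp_co).
Qed.

Lemma eq_period_int j k : eta j = eta k -> period_int j = period_int k.
Proof. by rewrite /period_int => ->. Qed.

Lemma period_int_mod k : period_int (k %% N) = period_int k.
Proof. exact/eq_period_int/(gauss_period_mod psi z_prim). Qed.

Lemma period_int_frob k : period_int (k * p) = period_int k.
Proof.
exact/eq_period_int/(gauss_period_frob charF psi_frob chi_mul gamma_gen z_prim p_co).
Qed.

Lemma period_int_shift k : ~~ (M %| k)%N -> period_int (k + M) = period_int k.
Proof.
move=> ndv.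
have [i ki] := shift_power p1_prime m_ge1 N_def f_def w_def coprime_N w_dvd ndv.
rewrite -period_int_mod ki period_int_mod.
by elim: i {ki} => [|i IHi]; rewrite ?muln1 // expnSr mulnA period_int_frob.
Qed.

Lemma om_prim : p1.-primitive_root om.
Proof.
have -> : M = (N %/ p1)%N by rewrite NE mulnK ?prime_gt0.
by apply: (dvdn_prim_root z_prim); rewrite NE dvdn_mull.
Qed.

(** Subtracting the constant [period_int 0] leaves the Fourier transform unchanged at nonzero
    frequencies and gives [beta 0 = 0], as [Fp_fourier_dvd] requires. *)
Definition beta (c : 'F_p1) : int := period_int (M * val c) - period_int 0.
Local Notation G := (Fp_fourier om beta).

Lemma beta0 : beta 0 = 0.
Proof. by rewrite /beta muln0 subrr. Qed.

Lemma beta_nat n : beta n%:R = period_int (M * n) - period_int 0.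
Proof. by rewrite /beta /= val_Fp_nat // muln_modr -NE period_int_mod. Qed.

Lemma beta_frob c : beta (p%:R * c) = beta c.
Proof.
by rewrite -[c]natr_Zp -natrM !beta_nat mulnCA mulnC period_int_frob.
Qed.

Lemma fourier_beta j : j != 0 ->
  G j = \sum_(c < p1) (om ^+ val j) ^+ c * (period_int (M * c))%:~R.
Proof.
move=> nj; rewrite -(sum_Fp p1_prime (fun c => (om ^+ val j) ^+ c * (period_int (M * c))%:~R)).
have eE c : Fp_char om (c * j) = (om ^+ val j) ^+ val c.
  by rewrite mulrC (Fp_charM p1_prime om_prim).
rewrite /Fp_fourier; under eq_bigr do rewrite /beta rmorphB mulrBl.
rewrite sumrB -[X in _ - X]mulr_sumr (sum_Fp_char p1_prime om_prim) (negbTE nj).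
rewrite muln0 mulr0 subr0; apply: eq_bigr => c _.
by rewrite eE mulrC.
Qed.

Let om_neq1 : om != 1.
Proof. by rewrite -(prim_order_dvd z_prim) NE gtnNdvd // ltn_Pmulr // prime_gt1. Qed.

Lemma gauss_sum_fourier : gauss_sum charF xi_p chi = G 1.
Proof.
rewrite fourier_beta ?oner_eq0 // /gauss_sum.
rewrite (gauss_sum_period psi chi_mul gamma_gen z_prim) NE.
under eq_bigr do rewrite -period_intE.
rewrite (root_sum_multiples (h := fun k => (period_int k)%:~R)) //.
- by move=> k /period_int_shift ->.
- by rewrite -NE (prim_expr_order z_prim).
Qed.

Lemma gauss_sum_conj_fourier :
  \sum_u (chi u)^-1 * psi (- val u) = G (-1).
Proof.
rewrite fourier_beta ?oppr_eq0 ?oner_eq0 //.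
rewrite (gauss_sum_conj psi chi_mul gamma_gen z_prim N_odd) NE.
under eq_bigr do rewrite -period_intE -exprVn.
rewrite (root_sum_multiples (h := fun k => (period_int k)%:~R)) //.
(* The inverse of [om] is identified with the power of [om] whose exponent represents -1 in
   ['F_p1]. *)
- apply: eq_bigr => c _; congr (_ ^+ _ * _).
  have om0 : om != 0 by rewrite (prim_root_eq0 om_prim) -lt0n prime_gt0.
  rewrite exprVn; apply: (mulfI om0); rewrite mulfV //.
  rewrite -[RHS]/(om * Fp_char om (-1)) -{1}[om]/(om ^+ 1).
  rewrite -(Fp_char_nat p1_prime om_prim 1) -(Fp_charD p1_prime om_prim) subrr.
  by rewrite /Fp_char expr0.
- by move=> k /period_int_shift ->.
- by rewrite exprVn invr_eq1.
- by rewrite -NE exprVn (prim_expr_order z_prim) invr1.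
Qed.

Lemma fourier_norm : G 1 * G (-1) = (p ^ f)%:R.
Proof.
rewrite -gauss_sum_fourier -gauss_sum_conj_fourier -card_F.
exact: (gauss_sum_norm psiD psi_sum chi_mul gamma_gen z_prim N_gt1).
Qed.

Lemma beta_moments :
  (p1%:Z - 1) * (p ^ f)%N%:Z + (\sum_c beta c) ^+ 2 = p1%:Z * \sum_c beta c ^+ 2.
Proof. exact: (Fp_parseval p1_prime om_prim fourier_norm). Qed.

(** All periods sum to -1. Those at indices not divisible by [M] occur in groups of [p1] equal ones,
    and [period_int 0] is subtracted [p1] times, so both disappear modulo [p1]. *)
Lemma sum_beta_mod : (p1%:Z %| (\sum_c beta c + 1)%R)%Z.
Proof.
have tot : \sum_(k < M * p1) period_int k = -1.
  apply: (@intr_inj algC); rewrite rmorph_sum rmorphN1.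
  under eq_bigr do rewrite /= period_intE.
  rewrite -NE; exact: (sum_gauss_period psi_sum chi_mul gamma_gen z_prim).
have := sum_multiples M_gt0 period_int_shift p1; rewrite tot.
rewrite -(sum_Fp p1_prime (fun c => period_int (M * c))) => tot'.
rewrite /beta sumrB sumr_const card_Fp // -[1]opprK tot' opprD.
set S := \sum_(c : 'F_p1) _; set X := \sum_(i < M | _) _.
have -> : S - period_int 0 *+ p1 + (- S - X *+ p1) = - (period_int 0 + X) * p1%:Z.
  by rewrite -(mulr_natr (period_int 0)) -(mulr_natr X) natz; ring.
by rewrite dvdz_mull.
Qed.

Lemma dvd_pow_beta c : ((p ^ r)%N%:Z %| beta c)%Z.
Proof.
apply: (Fp_fourier_dvd p1_prime om_prim); rewrite ?expn_gt0 ?prime_gt0 ?beta0 //.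
  by rewrite coprimeXl // -(coprime_modulus m_ge1 N_def).
by case: r_dvd => _; rewrite gauss_sum_fourier natrX.
Qed.

(** [chi] reads off the logarithm to base [gamma] modulo [N]. For the direction into [D], the
    exponent is first reduced below [#|F|.-1], which puts its quotient by [N] in the index range of
    the class. *)
Lemma mem_D (u : {unit F}) : (val u \in D) = [exists i : 'I_M, chi u == z ^+ i].
Proof.
have chiX v k : chi (v ^+ k)%g = chi v ^+ k by rewrite lin_charX ?inE.
have card_unitF : #[gamma]%g = #|F|.-1.
  by rewrite -card_finField_unit (eqP gamma_prim).
have dvN : (N %| #|F|.-1)%N.
  by rewrite (prim_order_dvd z_prim) -card_unitF -chiX expg_order lin_char1.
rewrite D_def; apply/bigcupP/existsP => [[i _ /imsetP[j _ /val_inj uE]]|[i /eqP ui]].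
  exists i; rewrite uE chiX exprD mulnC exprM (prim_expr_order z_prim).
  by rewrite expr1n mulr1.
exists i => //; have [k uk] := gamma_gen u.
pose n := (k %% #[gamma]%g)%N.
have un : u = (gamma ^+ n)%g by rewrite uk /n expg_mod ?expg_order.
have n_lt : (n < #|F|.-1)%N by rewrite -card_unitF ltn_mod order_gt0.
have nN : (n %% N = i)%N.
  have ltiN : (i < N)%N.
    by apply: leq_trans (ltn_ord i) _; rewrite NE leq_pmulr ?prime_gt0.
  move/eqP: ui; rewrite un chiX (eq_prim_root_expr z_prim) => /eqP ->.
  by rewrite modn_small.
have j_lt : (n %/ N < #|F|.-1 %/ N)%N by rewrite ltn_divLR ?(ltnW N_gt1) // divnK.
apply/imsetP; exists (Ordinal j_lt) => //=.
by rewrite un [in LHS](divn_eq n N) nN addnC.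
Qed.

Lemma D_unit x : x \in D -> exists u : {unit F}, x = val u.
Proof.
by rewrite D_def => /bigcupP[i _ /imsetP[j _ ->]]; eexists.
Qed.

Lemma D_not0 : 0 \notin D.
Proof.
apply/negP => /D_unit[u u0]; have := valP u.
by rewrite -u0 unitr0.
Qed.

Lemma D_opp x : (- x \in D) = (x \in D).
Proof.
have N1U : (-1 : F) \is a GRing.unit by rewrite unitrN1.
pose v : {unit F} := Sub (-1 : F) N1U.
have chiv : chi v = 1 := chiN1 chi_mul gamma_gen z_prim N_odd (erefl : val v = -1).
have opp y : y \in D -> - y \in D.
  move=> Dy; have [u yu] := D_unit Dy; have -> : - y = val (v * u)%g.
    by rewrite yu /= mulN1r.
  by move: Dy; rewrite yu !mem_D chi_mul chiv mul1r.
by apply/idP/idP => /opp; rewrite ?opprK.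
Qed.

Lemma char_sum_beta : exists C : int,
  (forall c, exists2 y, y != 0 & char_sum psi D y = (C + beta c)%:~R) /\
  (forall y, y != 0 -> exists c, char_sum psi D y = (C + beta c)%:~R).
Proof.
have [C [C_mul C_all]] := window_sum M_gt0 period_int_shift.
exists (C + period_int 0).
have leMN : (M <= N)%N by rewrite NE leq_pmulr ?prime_gt0.
have sumE a v : chi v = z ^+ a ->
    char_sum psi D (val v) = (\sum_(i < M) period_int (a + i))%:~R.
  move=> chiv.
  rewrite (char_sum_period psi chi_mul z_prim leMN D_not0 mem_D chiv) rmorph_sum.
  by apply: eq_bigr => i _; rewrite /= period_intE.
have betaE c : C + period_int 0 + beta c%:R = C + period_int (M * c).
  by rewrite beta_nat; ring.
split=> [c|y ny].
  exists (val (gamma ^+ (M * val c))%g).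
    by rewrite -unitfE; case: (gamma ^+ _)%g.
  rewrite (sumE (M * val c)%N) ?lin_charX ?inE // C_mul -betaE.
  by rewrite natr_Zp.
have yU : y \is a GRing.unit by rewrite unitfE.
have [a chia] := chi_log chi_mul gamma_gen z_prim (Sub y yU).
have [c cE] := C_all a.
by exists c%:R; rewrite betaE -cE -(sumE _ _ chia).
Qed.

(** Subtracting the quadratic equations of the eigenvalues [C + beta c] and [C] gives
    [beta c = P - 2 * C] whenever [beta c] is nonzero. Conversely [C] and [C + b] are the only
    eigenvalues. *)
Lemma srg_beta :
  strongly_regular (cayley D) <-> exists b, forall c, beta c = 0 \/ beta c = b.
Proof.
have [C [C_beta C_all]] := char_sum_beta.
split=> [srg | [b two]].
  have [P [Q quad]] := srg_char_sum_quadratic psiD psi_sum D_not0 D_opp srg.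
  have quadC c : ((C + beta c)%:~R : algC) ^+ 2 = P * (C + beta c)%:~R + Q.
    by have [y ny yE] := C_beta c; rewrite -yE quad.
  have betaP c : beta c != 0 -> (C + (C + beta c))%:~R = P.
    move=> nb; have nbC : (beta c)%:~R != 0 :> algC by rewrite intr_eq0.
    move: (quadC 0) (quadC c); rewrite beta0 addr0.
    move: (beta c) nbC => y ny E2 E1; apply: (mulIf ny).
    have -> : P * y%:~R = (C + y)%:~R ^+ 2 - C%:~R ^+ 2.
      by rewrite E1 E2 intrD; ring.
    by rewrite !intrD; ring.
  have [c0 nc0|all0] := pickP (fun c => beta c != 0); last first.
    by exists 0 => c; left; apply/eqP; rewrite -[_ == _]negbK all0.
  exists (beta c0) => c; have [|nc] := eqVneq (beta c) 0; [by left | right].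
  have := betaP c nc; rewrite -(betaP c0 nc0) => /intr_inj.
  by move/addrI/addrI.
have chiX v k : chi (v ^+ k)%g = chi v ^+ k by rewrite lin_charX ?inE.
apply: (two_char_sums_srg psiD psi_sum D_not0 D_opp (a := C%:~R) (b := (C + b)%:~R)).
- exists (val (1%g : {unit F})); rewrite mem_D; apply/existsP; exists (Ordinal M_gt0).
  by rewrite lin_char1.
- exists (val (gamma ^+ M)%g); apply/andP; split.
    by rewrite -unitfE; case: (gamma ^+ _)%g.
  rewrite mem_D; apply/existsPn => i.
  have ltMN : (M < N)%N by rewrite NE ltn_Pmulr // prime_gt1.
  rewrite chiX (eq_prim_root_expr z_prim) !modn_small //.
    by rewrite gtn_eqF.
  exact: ltn_trans (ltn_ord i) ltMN.
- move=> y /C_all[c ->]; case: (two c) => ->; [left | right]; by rewrite ?addr0.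
Qed.

(** Division by [p ^ k] keeps the coefficients of the Gauss sum integral. An element of the
    decomposition group sends [om] to [om ^+ t] with [t] inverse to a power of [p], and the
    coefficients are invariant under [p]. *)
Lemma in_decomposition_of_dvd k : (forall c, ((p ^ k)%N%:Z %| beta c)%Z) ->
  in_decomposition_int N p xi_N (p%:R ^- k * gauss_sum charF xi_p chi).
Proof.
move=> dv; rewrite gauss_sum_fourier.
have [j omE] : {j : 'I_N | om = xi_N ^+ j}.
  apply: (prim_rootP xi_N_prim).
  by rewrite exprAC (prim_expr_order z_prim) expr1n.
have np : p%:R ^+ k != 0 :> algC by rewrite expf_neq0 // pnatr_eq0 -lt0n prime_gt0.
have sumE : p%:R ^- k * G 1 =
    \sum_c (beta c %/ (p ^ k)%N%:Z)%Z%:~R * Fp_char om c.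
  rewrite mulr_sumr; apply: eq_bigr => c _.
  rewrite mulr1 -{1}(divzK (dv c)) rmorphM /= -pmulrn natrX.
  by field.
split; [split|]; last 1 first.
- rewrite sumE; apply: rpred_sum => c _.
  by rewrite rpredM ?Aint_int ?(Fp_char_Aint om_prim).
- rewrite sumE; apply: rpred_sum => c _; apply: Crat_spanM; first exact: rpred_int.
  by rewrite /Fp_char omE -exprM mem_cyclotomic_field.
move=> P P_prime s sP.
have f_ord := order_dvd_exp p1_prime m_ge1 N_def f_def coprime_N.
have [t [st [i ti]]] :=
  decomposition_power xi_N_prim p_prime p_co P_prime (f_gt0 f_def) f_ord sP.
rewrite rmorphM fmorphV rmorphXn rmorph_nat; congr (_ * _).
have s_om : s om = om ^+ t by rewrite omE rmorphXn st exprAC.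
rewrite /Fp_fourier rmorph_sum /=.
have tp1 : (p ^ i)%:R * t%:R = 1 :> 'F_p1.
  rewrite -natrM mulnC; apply/val_inj; rewrite /= !val_Fp_nat // Fp_cast //.
  by rewrite -(modn_dvdm _ (p1_dvd_N m_ge1 N_def)) ti modn_dvdm // (p1_dvd_N m_ge1 N_def).
have npi : (p ^ i)%:R != 0 :> 'F_p1.
  by apply/eqP => pi0; move: tp1; rewrite pi0 mul0r => /eqP; rewrite eq_sym oner_eq0.
have beta_pi c : beta ((p ^ i)%:R * c) = beta c.
  elim: (i) => [|k' IHk]; first by rewrite mul1r.
  by rewrite expnS natrM -mulrA beta_frob.
(* Reindexing by [p ^ i] undoes the exponent [t], without changing the coefficients. *)
rewrite (reindex_inj (mulfI npi)); apply: eq_bigr => c _ /=.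
rewrite rmorphM rmorph_int beta_pi; congr (_ * _).
have e_nat := Fp_char_nat p1_prime om_prim.
rewrite -[c]natr_Zp !mulr1 -natrM !e_nat rmorphXn s_om -(exprM om).
apply/eqP; rewrite (eq_prim_root_expr om_prim) mulnA.
have : (t * p ^ i)%:R = 1%:R :> 'F_p1 by rewrite natrM mulrC tp1.
move/(congr1 val); rewrite /= !val_Fp_nat // => tpi.
by rewrite -modnMml tpi [X in (1 %% X)%N](Fp_cast p1_prime) modnMml mul1n.
Qed.

(** * Two-valuedness of [beta] and the numerical conditions *)

Hypothesis r_max : ~ in_decomposition_int N p xi_N
  (p%:R ^- r.+1 * gauss_sum charF xi_p chi).

Let card_nz : nat := #|[pred c : 'F_p1 | beta c != 0]|.

Let p_gt0 : (0 < p)%N. Proof. exact: prime_gt0. Qed.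
Let p1_gt0 : (0 < p1)%N. Proof. exact: prime_gt0. Qed.
Let pow_gt0 k : (0 < p ^ k)%N. Proof. by rewrite expn_gt0 p_gt0. Qed.
Let ew : (e * w = p1 - 1)%N := mul_ew w_dvd.
Let e_gt1' : (1 < e)%N := e_gt1 p1_prime m_ge1 N_def p_prime f_def w_def coprime_N w_dvd.
Let w_gt0' : (0 < w)%N := w_gt0 p1_prime m_ge1 N_def f_def w_def.

Lemma beta_neq0 : exists c, beta c != 0.
Proof.
apply/existsP; apply: contraT => /existsPn all0.
have G0 : G 1 = 0.
  by apply: big1 => c _; move: (all0 c); rewrite negbK => /eqP ->; rewrite mul0r.
have := fourier_norm; rewrite G0 mul0r => /eqP.
by rewrite eq_sym pnatr_eq0 expn_eq0 (gtn_eqF p_gt0).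
Qed.

Lemma two_valued_sums (b : int) : (forall c, beta c = 0 \/ beta c = b) ->
  \sum_c beta c = b * card_nz%:Z /\ \sum_c beta c ^+ 2 = b ^+ 2 * card_nz%:Z.
Proof.
have sumE (h : int -> int) : (forall c, beta c = 0 \/ beta c = b) -> h 0 = 0 ->
    \sum_c h (beta c) = h b * card_nz%:Z.
  move=> two h0; rewrite (bigID (fun c => beta c != 0)) /= [X in _ + X]big1 ?addr0.
    rewrite (eq_bigr (fun=> h b)) => [|c nc]; first by rewrite sumr_const -mulr_natr natz.
    by case: (two c) nc => ->; rewrite ?eqxx.
  by move=> c; rewrite negbK => /eqP ->.
move=> two; split; first exact: (sumE id).
by apply: (sumE (fun x => x ^+ 2)); rewrite ?expr0n.
Qed.

(** [dvd_sum_stable] applied to the indicator of the support of [beta]. *)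
Lemma dvd_e_card : (e %| card_nz)%N.
Proof.
have dv : (e%:Z %| (\sum_(c : 'F_p1 | c != 0) (beta c != 0 : nat)%:Z)%R)%Z.
  apply: (dvd_sum_stable p1_prime m_ge1 N_def f_def w_def coprime_N w_dvd) => c.
  by rewrite beta_frob.
move: dv; rewrite sum_Fp_nz ?beta0 //.
suff -> : \sum_c (beta c != 0 : nat)%:Z = card_nz%:Z by [].
rewrite -[RHS]natz -[RHS]sumr_const [RHS]big_mkcond; apply: eq_bigr => c _.
by rewrite inE; case: (beta c != 0).
Qed.

(** [b ^+ 2] divides [p ^ f], so [b] is up to sign some [p ^ k]. If [k > r], then [p ^ r.+1] divides
    every [beta c], against [r_max]; [k < r] contradicts [dvd_pow_beta]. *)
Lemma two_valued_abs (b : int) : (exists c, beta c = b) -> b != 0 ->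
  (forall c, beta c = 0 \/ beta c = b) -> `|b|%N = (p ^ r)%N.
Proof.
move=> [c0 bc0] nb two.
have := Fp_fourier_sqr_dvd om_prim nb two fourier_norm.
rewrite dvdzE abszX /= => dv2.
have [k _ bk] : exists2 k, (k <= f)%N & `|b|%N = (p ^ k)%N.
  by apply/(dvdn_pfactor _ _ p_prime)/(dvdn_trans _ dv2); rewrite dvdn_exp.
rewrite bk; congr (_ ^ _)%N; apply/eqP; rewrite eqn_leq; apply/andP; split.
  rewrite leqNgt; apply/negP => ltrk; apply: r_max; apply: in_decomposition_of_dvd => c.
  case: (two c) => ->; rewrite ?dvdz0 // dvdzE /= bk.
  exact: dvdn_exp2l.
have := dvd_pow_beta c0; rewrite bc0 dvdzE /= bk.
by rewrite dvdn_Pexp2l ?prime_gt1.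
Qed.


Lemma PoszX k : p%:Z ^+ k = (p ^ k)%N%:Z.
Proof. by rewrite -[RHS]natz natrX natz. Qed.

Let srg_condition (l : nat) (eps : int) :=
  [/\ (1 <= l <= w - 1)%N,
      eps = 1 \/ eps = -1,
      (((p%:Z ^+ r * (1 - p1%:Z) * l%:Z) %/ w%:Z)%Z = eps %[mod p1%:Z])%Z
    & p%:Q ^ (f%:Z - 2 * r%:Z) = l%:Q / w%:Q * (p1%:Q - (p1%:Q - 1) * l%:Q / w%:Q)].

Lemma srg_conditionE l eps : srg_condition l eps <->
  [/\ (1 <= l <= w - 1)%N,
      eps = 1 \/ eps = -1,
      (p1%:Z %| (p ^ r)%N%:Z * (e * l)%N%:Z + eps)%Z
    & (p1%:Z - 1) * (p ^ f)%N%:Z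
      = (p ^ r)%N%:Z ^+ 2 * (p1%:Z * (e * l)%N%:Z - (e * l)%N%:Z ^+ 2)].
Proof.
have powE := power_identity_int f r l p_gt0 (ltnW e_gt1') w_gt0' p1_gt0 ew.
rewrite /srg_condition PoszX (int_divz_factor _ _ w_gt0' ew p1_gt0).
have modE : (- ((p ^ r)%N%:Z * (e * l)%N%:Z) = eps %[mod p1%:Z])%Z <->
    (p1%:Z %| (p ^ r)%N%:Z * (e * l)%N%:Z + eps)%Z.
  split=> [/eqP|dv]; last apply/eqP.
    by rewrite eqz_mod_dvd -opprD rpredN.
  by rewrite eqz_mod_dvd -opprD rpredN.
split=> [[h1 h2 /modE h3 /powE h4]|[h1 h2 /modE h3 /powE h4]]; exact: And4.
Qed.

Lemma srg_condition_of_two_valued :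
  (exists b, forall c, beta c = 0 \/ beta c = b) -> exists l eps, srg_condition l eps.
Proof.
move=> [b two]; have [c0 nc0] := beta_neq0.
have bc0 : beta c0 = b by case: (two c0) nc0 => ->; rewrite ?eqxx.
have nb : b != 0 by rewrite -bc0.
have absb := two_valued_abs (ex_intro _ c0 bc0) nb two.
have b2 : b ^+ 2 = (p ^ r)%N%:Z ^+ 2 by rewrite -absb abszE real_normK ?num_real.
have [sumb sumb2] := two_valued_sums two.
have /dvdnP[l Ll] := dvd_e_card; rewrite mulnC in Ll.
have moments : (p1%:Z - 1) * (p ^ f)%N%:Z
    = (p ^ r)%N%:Z ^+ 2 * (p1%:Z * card_nz%:Z - card_nz%:Z ^+ 2).
  have := beta_moments; rewrite sumb sumb2 -b2 => mom.
  by apply: (addIr ((b * card_nz%:Z) ^+ 2)); rewrite mom; ring.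
pose eps : int := sgz b.
have epsP : eps = 1 \/ eps = -1 by rewrite /eps; case: sgzP nb; [by [] | left | right].
have bE : b = eps * (p ^ r)%N%:Z by rewrite -absb; exact: intEsg.
have eps2 : eps ^+ 2 = 1 by case: epsP => ->.
have card_gt0 : (0 < card_nz)%N by apply/card_gt0P; exists c0; rewrite inE.
have l_gt0 : (0 < l)%N by move: card_gt0; rewrite Ll muln_gt0 => /andP[].
have le_lw : (l <= w)%N.
  rewrite -(leq_pmul2l (ltnW e_gt1')) -Ll ew subn1.
  have := cardC1 (0 : 'F_p1); rewrite card_Fp // => <-.
  apply/subset_leq_card/subsetP => c; rewrite !inE.
  by apply: contra => /eqP ->; rewrite beta0.
(* For [l = w] the moment identity reduces to [p ^ f = p ^ (r * 2)], but [f] is odd. *)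
have neq_lw : l != w.
  apply/eqP => lw; have p1n : p1%:Z - 1 != 0.
    by rewrite subr_eq0 -[1]/(1%:Z) eqz_nat gtn_eqF ?prime_gt1.
  have cardE : card_nz%:Z = p1%:Z - 1 by rewrite Ll lw ew subzn.
  have : (p1%:Z - 1) * (p ^ f)%N%:Z = (p1%:Z - 1) * (p ^ (r * 2))%N%:Z.
    by rewrite moments cardE expnM -[((p ^ r) ^ 2)%N%:Z]natz natrX natz; ring.
  move/(mulfI p1n) => [] /eqP; rewrite eqn_exp2l ?prime_gt1 // => /eqP fE.
  have := odd_f p1_prime m_ge1 N_def p_prime f_def Nm1_notin coprime_N.
  by rewrite fE oddM andbF.
exists l, eps; apply/srg_conditionE; rewrite -Ll; split=> //.
  by rewrite l_gt0 subn1 -ltnS prednK ?w_gt0' // ltn_neqAle neq_lw.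
have := sum_beta_mod; rewrite sumb bE => dv.
have -> : (p ^ r)%N%:Z * card_nz%:Z + eps =
    eps * (eps * (p ^ r)%N%:Z * card_nz%:Z + 1).
  by rewrite mulrDr mulr1 !mulrA -expr2 eps2 mul1r.
by rewrite dvdz_mull.
Qed.

Lemma two_valued_of_srg_condition :
  (exists l eps, srg_condition l eps) -> exists b, forall c, beta c = 0 \/ beta c = b.
Proof.
move=> [l [eps /srg_conditionE[_ epsP dv mom]]].
set q := (p ^ r)%N%:Z in dv mom; set L := (e * l)%N%:Z in dv mom.
have nq : q != 0 by rewrite -lt0n pow_gt0.
have eps2 : eps ^+ 2 = 1 by case: epsP => ->.
pose alpha c := (beta c %/ q)%Z.
have betaE c : beta c = alpha c * q by rewrite divzK ?dvd_pow_beta.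
have sumE : \sum_c beta c = (\sum_c alpha c) * q.
  by rewrite mulr_suml; apply: eq_bigr => c _; exact: betaE.
have sum2E : \sum_c beta c ^+ 2 = (\sum_c alpha c ^+ 2) * q ^+ 2.
  by rewrite mulr_suml; apply: eq_bigr => c _; rewrite betaE exprMn.
have alpha0 : alpha 0 = 0 by rewrite /alpha beta0 div0z.
exists (eps * q) => c.
have dvT : (e%:Z %| (\sum_c alpha c)%R)%Z.
  rewrite -sum_Fp_nz ?alpha0 //.
  apply: (dvd_sum_stable p1_prime m_ge1 N_def f_def w_def coprime_N w_dvd) => d.
  by rewrite /alpha beta_frob.
have dvL : (e%:Z %| L)%Z by rewrite /L PoszM dvdz_mulr.
have dvTL : (p1%:Z %| (\sum_c alpha c - eps * L)%R)%Z.
  have co : coprimez p1%:Z q.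
    rewrite /q coprimezE /= coprime_sym coprimeXl //.
    by rewrite -(coprime_modulus m_ge1 N_def).
  rewrite -(Gauss_dvdzr _ co).
  (* The sum of the [beta c] and the product [eps * q * L] are both -1 modulo [p1], the latter
     because [eps ^+ 2 = 1]; [q] is then cancelled, being prime to [p1]. *)
  have -> : q * (\sum_c alpha c - eps * L) = (\sum_c beta c + 1) - eps * (q * L + eps).
    by rewrite sumE [eps * (_ + _)]mulrDr -expr2 eps2; ring.
  by rewrite rpredB ?sum_beta_mod // dvdz_mull.
have momL : p1%:Z * \sum_c alpha c ^+ 2 - (\sum_c alpha c) ^+ 2 = p1%:Z * L - L ^+ 2.
  have := beta_moments; rewrite mom sumE sum2E => mom'.
  apply: (mulfI (expf_neq0 2 nq)); move: mom'.
  move: (\sum_c alpha c) (\sum_c alpha c ^+ 2) => T U mom'.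
  apply: (addIr ((T * q) ^+ 2)).
  by rewrite mom'; ring.
rewrite betaE.
by have [->|->] := two_valued_of_moments p1_prime e_gt1' ew alpha0 epsP dvT dvL dvTL momL c;
  [left; rewrite mul0r | right].
Qed.

Lemma srg_iff_condition :
  strongly_regular (cayley D) <-> exists l eps, srg_condition l eps.
Proof.
split=> [/srg_beta|/two_valued_of_srg_condition] //.
  exact: srg_condition_of_two_valued.
by move/srg_beta.
Qed.

End StrongRegularity.

Theorem theorem3p3
  (p1 m N p f w : nat)
  (p1_prime : prime p1) (m_ge1 : (1 <= m)%N) (N_def : N = (p1 ^ m)%N)
  (p_prime : prime p) (p_neq_p1 : p <> p1)
  (f_def : f = #[unit_mod N p%:Z]%g) (w_def : w = (totient N %/ f)%N)
  (F : finFieldType) (charF : p \in [pchar F]) (card_F : #|F| = (p ^ f)%N)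
  (Nm1_notin : unit_mod N (-1) \notin <[unit_mod N p%:Z]>%g)
  (coprime_N : gcdn (p * (p - 1)) N = 1%N)
  (w_dvd : (w %| p1 - 1)%N)
  (xi_p : algC) (xi_p_prim : p.-primitive_root xi_p)
  (xi_N : algC) (xi_N_prim : N.-primitive_root xi_N)
  (chi : 'CF([set: {unit F}])) (chi_char : chi \is a linear_char)
  (chi_order : #[chi]%CF = N)
  (r : nat)
  (r_dvd : in_decomposition_int N p xi_N
             (p%:R ^- r * gauss_sum charF xi_p chi))
  (r_max : ~ in_decomposition_int N p xi_N
             (p%:R ^- r.+1 * gauss_sum charF xi_p chi))
  (gamma : {unit F}) (gamma_prim : generator [set: {unit F}] gamma)
  (D : {set F})
  (D_def : D = (\bigcup_(i < p1 ^ (m - 1)) cyclotomic_class gamma N i)%SET) :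
  strongly_regular (cayley D) <->
  exists (l : nat) (eps : int),
    [/\ (1 <= l <= w - 1)%N,
        eps = 1 \/ eps = -1,
        (((p%:Z ^+ r * (1 - p1%:Z) * l%:Z) %/ w%:Z)%Z = eps %[mod p1%:Z])%Z
      & let s : int := f%:Z - 2 * r%:Z in
        p%:Q ^ s = l%:Q / w%:Q * (p1%:Q - (p1%:Q - 1) * l%:Q / w%:Q)].
Proof.
exact: (srg_iff_condition p1_prime m_ge1 N_def p_prime f_def w_def card_F
  Nm1_notin coprime_N w_dvd xi_p_prim xi_N_prim chi_char chi_order r_dvd
  gamma_prim D_def r_max).
Qed.
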